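(* Let $\mathcal{Q}$ be the class of quasi thick forests. There is a deterministic polynomial-time algorithm which, given a graph $G\in\mathcal{Q}$ with non-negative rational vertex weights $w(v)$, $v\in V(G)$, computes exactly the total weight of independent sets $W(G)=\sum_{S}\prod_{v\in S}w(v)$, where the sum is over all independent sets $S$ of $G$ (including $\emptyset$).
   Context: All graphs are simple, finite and undirected. A graph is cobipartite if its complement is bipartite. A clique separator of $G=(V,E)$ is a (possibly empty) clique $S\subseteq V$ for which there are $V_1,V_2\subseteq V$ with $V=V_1\cup V_2$, $V_1\cap V_2=S$, $V_1\setminus S\neq\emptyset\neq V_2\setminus S$, and no edge of $G$ between $V_1\setminus S$ and $V_2\setminus S$. A clique cutset decomposition of $G$ is obtained recursively: if $G$ is a clique or has no clique separator, then $G$ is itself an atom; otherwise one chooses a clique separator $S$ of $G$ together with sets $V_1,V_2\subseteq V$ such that $V=V_1\cup V_2$, $V_1\cap V_2=S$, $V_1\setminus S\neq\emptyset\neq V_2\setminus S$, and there is no edge of $G$ between $V_1\setminus S$ and $V_2\setminus S$, and decomposes $G[V_1]$ and $G[V_2]$. The leaves of the resulting tree are the atoms. A graph is a quasi thick forest, i.e. belongs to $\mathcal{Q}$, if all atoms of a clique cutset decomposition of it are either cliques or cobipartite graphs with no clique separator. *)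

(* Defs.v *)
From HB Require Import structures.
From mathcomp Require Import all_boot all_order all_algebra.
Set Implicit Arguments.
Unset Strict Implicit.
Unset Printing Implicit Defensive.

Import GRing.Theory Num.Theory.

(* Graphs.  A simple graph G is a symmetric irreflexive relation [e] on a
   finite vertex type [V]; the induced subgraph G[A] is the vertex set [A]. *)
Section Graphs.
Variables (V : finType) (e : rel V).

Definition simple_graph : Prop := symmetric e /\ irreflexive e.

Definition clique (A : {set V}) : bool :=
  [forall x in A, forall y in A, (x != y) ==> e x y].

Definition independent (A : {set V}) : bool :=
  [forall x in A, forall y in A, ~~ e x y].

Definition bipartite (A : {set V}) : bool :=
  [exists B : {set V}, independent (A :&: B) && independent (A :\: B)].

Definition compl_graph : rel V := [rel x y | (x != y) && ~~ e x y].

(* [S] is a clique separator of G[A], as witnessed by [V1] and [V2]. *)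
Definition clique_separation (A S V1 V2 : {set V}) : bool :=
  [&& clique S, A == V1 :|: V2, V1 :&: V2 == S,
      V1 :\: S != set0, V2 :\: S != set0 &
      [forall x in V1 :\: S, forall y in V2 :\: S, ~~ e x y]].

Definition has_clique_separator (A : {set V}) : bool :=
  [exists S : {set V}, exists V1 : {set V}, exists V2 : {set V},
    clique_separation A S V1 V2].

(* [clique_cutset_decomposition A s]: the leaves of some clique cutset
   decomposition tree of G[A], from left to right, are [s]. *)
Inductive clique_cutset_decomposition : {set V} -> seq {set V} -> Prop :=
| DecompAtom (A : {set V}) :
    clique A || ~~ has_clique_separator A ->
    clique_cutset_decomposition A [:: A]
| DecompSplit (A S V1 V2 : {set V}) (s1 s2 : seq {set V}) :
    ~~ clique A -> clique_separation A S V1 V2 ->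
    clique_cutset_decomposition V1 s1 ->
    clique_cutset_decomposition V2 s2 ->
    clique_cutset_decomposition A (s1 ++ s2).

End Graphs.

Definition cobipartite (V : finType) (e : rel V) (A : {set V}) : bool :=
  bipartite (compl_graph e) A.

Definition quasi_thick_forest (V : finType) (e : rel V) : Prop :=
  exists2 atoms : seq {set V},
    clique_cutset_decomposition e [set: V] atoms &
    forall A : {set V}, A \in atoms ->
      clique e A || (cobipartite e A && ~~ has_clique_separator e A).

Definition indep_weight (V : finType) (e : rel V) (w : V -> rat) : rat :=
  (\sum_(S : {set V} | independent e S) \prod_(v in S) w v)%R.

(* Model of computation: the WHILE language over binary trees (N. D. Jones,
   Computability and Complexity, 1997), whose polynomial-time computable
   functions are those of Turing machines.  Jones charges one unit per
   operation, which is justified by sharing subtrees; here every operation is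
   instead charged the full size of the tree it produces, so that the running
   time also bounds the work of an implementation that copies its data. *)
Inductive tree := Leaf | Node of tree & tree.

Fixpoint tree_size (t : tree) : nat :=
  if t is Node l r then (tree_size l + tree_size r).+1 else 1.

Inductive expr :=
| Var of nat
| ELeaf
| ENode of expr & expr
| ELeft of expr
| ERight of expr.

Inductive cmd :=
| Assign of nat & expr
| Seq of cmd & cmd
| If of expr & cmd & cmd
| While of expr & cmd.

Definition store := nat -> tree.

Fixpoint eval (a : expr) (s : store) : tree :=
  match a with
  | Var i => s i
  | ELeaf => Leaf
  | ENode a1 a2 => Node (eval a1 s) (eval a2 s)
  | ELeft a1 => if eval a1 s is Node l _ then l else Leaf
  | ERight a1 => if eval a1 s is Node _ r then r else Leaf
  end.

Fixpoint eval_time (a : expr) (s : store) : nat :=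
  tree_size (eval a s) +
  match a with
  | Var _ | ELeaf => 0
  | ENode a1 a2 => eval_time a1 s + eval_time a2 s
  | ELeft a1 | ERight a1 => eval_time a1 s
  end.

Definition is_node (t : tree) : bool := if t is Node _ _ then true else false.

(* [exec c s t s']: started in store [s], the command [c] halts in store [s']
   after time [t].  Tests succeed on every tree other than [Leaf]. *)
Inductive exec : cmd -> store -> nat -> store -> Prop :=
| ExecAssign i a s :
    exec (Assign i a) s (eval_time a s).+1 [eta s with i |-> eval a s]
| ExecSeq c1 c2 s1 t1 s2 t2 s3 :
    exec c1 s1 t1 s2 -> exec c2 s2 t2 s3 ->
    exec (Seq c1 c2) s1 (t1 + t2).+1 s3
| ExecIfTrue a c1 c2 s t s' :
    is_node (eval a s) -> exec c1 s t s' ->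
    exec (If a c1 c2) s (eval_time a s + t).+1 s'
| ExecIfFalse a c1 c2 s t s' :
    ~~ is_node (eval a s) -> exec c2 s t s' ->
    exec (If a c1 c2) s (eval_time a s + t).+1 s'
| ExecWhileFalse a c s :
    ~~ is_node (eval a s) ->
    exec (While a c) s (eval_time a s).+1 s
| ExecWhileTrue a c s1 t1 s2 t2 s3 :
    is_node (eval a s1) -> exec c s1 t1 s2 -> exec (While a c) s2 t2 s3 ->
    exec (While a c) s1 (eval_time a s1 + t1 + t2).+1 s3.

(* Variable 0 holds the input at the start and the output at the end; all
   other variables are initially [Leaf]. *)
Definition runs (p : cmd) (x : tree) (t : nat) (y : tree) : Prop :=
  exists2 s : store,
    exec p [eta (fun=> Leaf) with 0 |-> x] t s & s 0 = y.

Lemma exec_deterministic c s t1 s1 t2 s2 :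
  exec c s t1 s1 -> exec c s t2 s2 -> t1 = t2 /\ s1 = s2.
Proof.
move=> H; elim: H t2 s2 => {c s t1 s1};
  intros; match goal with H : exec _ _ ?t ?s |- _ = ?t /\ _ = ?s =>
    inversion H; subst => // end;
  repeat match goal with
  | h1 : is_true (is_node ?x), h2 : is_true (~~ is_node ?x) |- _ =>
      by rewrite h1 in h2
  | IH : (forall t s, exec ?c ?s0 t s -> _), h : exec ?c ?s0 _ _ |- _ =>
      case: (IH _ _ h) => ? ?; subst; clear h
  end; by [].
Qed.

Definition enc_bool (b : bool) : tree := if b then Node Leaf Leaf else Leaf.

Definition enc_seq (s : seq tree) : tree := foldr Node Leaf s.

(* Binary digits, least significant first, without leading zeros:
   [up_log 2 n.+1] is the binary length of [n]. *)
Definition bits (n : nat) : seq bool :=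
  mkseq (fun i => odd (n %/ 2 ^ i)) (up_log 2 n.+1).

Definition enc_nat (n : nat) : tree := enc_seq (map enc_bool (bits n)).

(* A non-negative rational is given by its numerator and denominator in lowest
   terms. *)
Definition enc_rat (q : rat) : tree :=
  Node (enc_nat `|numq q|%N) (enc_nat `|denq q|%N).

(* Adjacency matrix and list of weights, in the order of [enum V]. *)
Definition enc_weighted_graph (V : finType) (e : rel V) (w : V -> rat) : tree :=
  Node (enc_seq [seq enc_seq [seq enc_bool (e x y) | y <- enum V]
                | x <- enum V])
       (enc_seq [seq enc_rat (w x) | x <- enum V]).

(* Main.v *)
Require Import Defs.
From mathcomp Require Import all_boot all_order all_algebra.
From mathcomp Require Import zify ring.
Set Implicit Arguments.
Unset Strict Implicit.
Unset Printing Implicit Defensive.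

(** Only two features of the atoms matter: they contain no independent set of
    size three, and they are glued along cliques.  It follows that every
    nonempty induced subgraph [G[A]] contains a nonempty set [X] whose
    neighbourhood in [A \ X] is a clique, and that together with this
    neighbourhood contains no independent triple.  Since an independent set
    meets the neighbourhood in at most one vertex, summing over the part of the
    independent sets inside [X] yields a factor [W(X)] and replaces each
    remaining weight [u v] by [u v * W(X \ N(v)) / W(X)].  A minimal such [X]
    is found by closing two nonadjacent vertices under the induced paths on
    three or four vertices (longer induced paths contain independent triples),
    and taking the vertices without neighbours outside this closure.

    When the vertices outside [A] have been eliminated with total factor [F],
    one has [F * W_u(B) = W_w(B U ~A)] for all [B] inside [A].  Hence [F] and
    the weights [u v] are quotients of integers below the product of the
    [num (w v) + den (w v)], and keeping fractions reduced by Euclid's algorithm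
    bounds the size of all numbers. *)

(** * Polynomial time on trees *)

(** The program never sees a decomposition and never searches for minimal sets. It forms the closure
    of every pair of vertices and eliminates whenever this closure passes a local test, which alone
    makes the elimination exact. The decomposition only serves to show that in every remaining graph
    some pair passes the test and removes a vertex, so one sweep over all pairs per vertex suffices.
    A suitable [X] is lifted through a decomposition by a stronger claim: it can be chosen to avoid
    any prescribed clique. Otherwise a set found on one side of a separator might meet the separator
    and have neighbours on the other side. On the side of complexity, the obstacle is that
    polynomial-time functions are not closed under iteration. Every loop therefore comes with a
    bound on its intermediate values in terms of the input, and the invariants behind such bounds
    are put into the index types of [ptime], so that a loop body is analysed only on states that
    satisfy them. *)

Lemma tree_size_gt0 t : 0 < tree_size t.
Proof. by case: t. Qed.

Definition pbound I (X : I -> tree) (f : I -> nat) : Prop :=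
  exists c k, forall i, f i <= c * tree_size (X i) ^ k.

Section Bounds.
Variables (I : Type) (X : I -> tree).
Implicit Types f g : I -> nat.

Lemma pbound_le f g : pbound X g -> (forall i, f i <= g i) -> pbound X f.
Proof. by move=> [c [k H]] fg; exists c, k => i; apply: leq_trans (H i). Qed.

Lemma pbound_const n : pbound X (fun=> n).
Proof. by exists n, 0 => i; rewrite expn0 muln1. Qed.

Lemma pbound_size : pbound X (fun i => tree_size (X i)).
Proof. by exists 1, 1 => i; rewrite mul1n expn1. Qed.

Lemma pbound_add f g :
  pbound X f -> pbound X g -> pbound X (fun i => f i + g i).
Proof.
move=> [c [k H]] [c' [k' H']]; exists (c + c'), (k + k') => i.
rewrite mulnDl leq_add //.
  apply: leq_trans (H i) _; rewrite leq_mul2l leq_pexp2l ?orbT ?leq_addr //.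
  exact: tree_size_gt0.
apply: leq_trans (H' i) _; rewrite leq_mul2l leq_pexp2l ?orbT ?leq_addl //.
exact: tree_size_gt0.
Qed.

Lemma pbound_mul f g :
  pbound X f -> pbound X g -> pbound X (fun i => f i * g i).
Proof.
move=> [c [k H]] [c' [k' H']]; exists (c * c'), (k + k') => i.
by rewrite expnD mulnACA leq_mul.
Qed.

Lemma pbound_succ f : pbound X f -> pbound X (fun i => (f i).+1).
Proof.
move=> bf; apply: (pbound_le (pbound_add bf (pbound_const 1))) => i.
by rewrite addn1.
Qed.

Lemma pbound_exp f n : pbound X f -> pbound X (fun i => f i ^ n).
Proof.
move=> bf; elim: n => [|n IH]; first exact: pbound_const.
by apply: (pbound_le (pbound_mul bf IH)) => i; rewrite expnS.
Qed.

Lemma pbound_comp (Y : I -> tree) f :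
  pbound X (fun i => tree_size (Y i)) -> pbound Y f -> pbound X f.
Proof.
move=> bY [c [k H]].
exact: pbound_le (pbound_mul (pbound_const c) (pbound_exp k bY)) H.
Qed.

End Bounds.

Ltac pbound_tac :=
  repeat lazymatch goal with
  | |- pbound _ (fun i => (@?f i + @?g i)%N) =>
      apply: (pbound_add (f := f) (g := g))
  | |- pbound _ (fun i => (@?f i).+1) =>
      apply: (pbound_succ (f := f))
  | |- pbound _ (fun i => (@?f i * @?g i)%N) =>
      apply: (pbound_mul (f := f) (g := g))
  | |- pbound _ (fun i => (@?f i ^ _)%N) =>
      apply: (pbound_exp (f := f))
  | |- pbound _ _ =>
      first [assumption | exact: pbound_size | exact: pbound_const]
  end.

Lemma pbound_reindex I J (h : J -> I) (X : I -> tree) f :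
  pbound X f -> pbound (X \o h) (f \o h).
Proof. by move=> [c [k H]]; exists c, k => j; apply: H. Qed.

(* [Y i] is computed from [X i] in time polynomial in the size of [X i],
   uniformly in [i].  The index type [I] carries the promises on the input;
   the variables above [m] are left alone by the program. *)
Definition ptime I (X Y : I -> tree) : Prop :=
  exists (p : cmd) (m : nat) (b : I -> nat),
    [/\ pbound X b, forall i, tree_size (Y i) <= b i
      & forall i s, s 0 = X i -> exists t s',
          [/\ exec p s t s', s' 0 = Y i, forall j, m < j -> s' j = s j
            & t <= b i]].

(** * Sequencing, pairing and branching *)

Section Combinators.
Variables (I : Type) (X : I -> tree).
Implicit Types Y Z C : I -> tree.

Lemma ptime_size Y : ptime X Y -> pbound X (fun i => tree_size (Y i)).
Proof. by move=> [p [m [b [bb bY _]]]]; apply: pbound_le bb bY. Qed.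

Lemma eq_ptime Y Z : ptime X Y -> Y =1 Z -> ptime X Z.
Proof.
move=> [p [m [b [bb bY H]]]] YZ; exists p, m, b; split=> // [i|i s Hs].
  by rewrite -YZ.
by case: (H i s Hs) => t [s' [? ? ? ?]]; exists t, s'; rewrite -YZ.
Qed.

Lemma ptime_expr (a : expr) Y :
  pbound X (fun i => tree_size (Y i)) ->
  (forall i s, s 0 = X i -> eval a s = Y i) ->
  pbound X (fun i => eval_time a (fun=> X i)) ->
  (forall i s, s 0 = X i -> eval_time a s = eval_time a (fun=> X i)) ->
  ptime X Y.
Proof.
move=> bY eY bt et; exists (Assign 0 a), 0.
exists (fun i => (tree_size (Y i) + eval_time a (fun=> X i)) + 1); split.
- by pbound_tac.
- by move=> i; rewrite -addnA leq_addr.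
move=> i s Hs; exists (eval_time a s).+1, [eta s with 0 |-> eval a s].
split; first exact: ExecAssign.
- by rewrite /= (eY _ _ Hs).
- by case.
by rewrite (et _ _ Hs) addn1 ltnS leq_addl.
Qed.

Lemma ptime_id : ptime X X.
Proof.
apply: (ptime_expr (a := Var 0)) => //=; try exact: pbound_size.
- by pbound_tac.
- by move=> i s ->.
Qed.

Lemma ptime_leaf : ptime X (fun=> Leaf).
Proof.
by apply: (ptime_expr (a := ELeaf)) => //=; apply: pbound_const.
Qed.

Definition left_tree t := if t is Node l _ then l else Leaf.
Definition right_tree t := if t is Node _ r then r else Leaf.

Lemma left_tree_size t : tree_size (left_tree t) <= tree_size t.
Proof. by case: t => //= l r; apply: leqW; apply: leq_addr. Qed.

Lemma right_tree_size t : tree_size (right_tree t) <= tree_size t.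
Proof. by case: t => //= l r; apply: leqW; apply: leq_addl. Qed.

Lemma ptime_left0 : ptime X (fun i => left_tree (X i)).
Proof.
have bl := pbound_le (pbound_size X) (fun i => left_tree_size (X i)).
apply: (ptime_expr (a := ELeft (Var 0))) => //=.
- by move=> i s ->.
- by pbound_tac.
- by move=> i s ->.
Qed.

Lemma ptime_right0 : ptime X (fun i => right_tree (X i)).
Proof.
have bl := pbound_le (pbound_size X) (fun i => right_tree_size (X i)).
apply: (ptime_expr (a := ERight (Var 0))) => //=.
- by move=> i s ->.
- by pbound_tac.
- by move=> i s ->.
Qed.

(** [ptime] prescribes only variable 0 of the initial store, so the second program may start among
    the leftovers of the first. *)
Lemma ptime_trans Y Z : ptime X Y -> ptime Y Z -> ptime X Z.
Proof.
move=> pY; have bY := ptime_size pY.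
move: pY => [p [m [b [bb sY H]]]] [p' [m' [b' [bb' sZ H']]]].
exists (Seq p p'), (maxn m m'), (fun i => b i + b' i + 1); split.
- by pbound_tac; apply: pbound_comp bb'.
- by move=> i; apply: leq_trans (sZ i) _; lia.
move=> i s /H [t [s1 [E1 Y1 fr1 T1]]].
have [t' [s2 [E2 Y2 fr2 T2]]] := H' _ _ Y1.
exists (t + t').+1, s2; split=> //; first exact: ExecSeq E1 E2.
- by move=> j; rewrite gtn_max => /andP[mj mj']; rewrite fr2 // fr1.
by rewrite addn1 ltnS leq_add.
Qed.

(** Both programs overwrite variable 0, so the input and the first result are parked in [v] and
    [v.+1], above the variables that either program changes. *)
Lemma ptime_node Y Z : ptime X Y -> ptime X Z ->
  ptime X (fun i => Node (Y i) (Z i)).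
Proof.
move=> [p [m [b [bb sY H]]]] [p' [m' [b' [bb' sZ H']]]].
have [v [mv mv']] : exists v, m < v /\ m' < v by exists (m + m').+1; lia.
exists (Seq (Assign v (Var 0)) (Seq p (Seq (Assign v.+1 (Var 0))
  (Seq (Assign 0 (Var v)) (Seq p' (Assign 0 (ENode (Var v.+1) (Var 0)))))))).
exists v.+1.
exists (fun i => 20 + 5 * tree_size (X i) + 5 * b i + 5 * b' i); split.
- by pbound_tac.
- by move=> i /=; move: (sY i) (sZ i); lia.
move=> i s Hs.
pose s1 := [eta s with v |-> eval (Var 0) s].
have s1E : s1 0 = X i by rewrite /s1 /= ltn_eqF //; lia.
have [t1 [s2 [E2 Y2 fr2 T2]]] := H i s1 s1E.
pose s3 := [eta s2 with v.+1 |-> eval (Var 0) s2].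
pose s4 := [eta s3 with 0 |-> eval (Var v) s3].
have s4E : s4 0 = X i.
  by rewrite /s4 /= ltn_eqF // fr2 // /s1 /= eqxx.
have [t5 [s5 [E5 Y5 fr5 T5]]] := H' i s4 s4E.
pose s6 := [eta s5 with 0 |-> eval (ENode (Var v.+1) (Var 0)) s5].
have s5v : s5 v.+1 = Y i by rewrite fr5 ?(ltn_trans mv') // /s4 /s3 /= eqxx.
eexists _, s6; split.
- do !apply: ExecSeq; [exact: ExecAssign|exact: E2|exact: ExecAssign|
    exact: ExecAssign|exact: E5|exact: ExecAssign].
- by rewrite /s6 /= s5v Y5.
- move=> j vj; have j0 : (j == 0) = false by case: j vj.
  rewrite /s6 /= j0 fr5; last by lia.
  rewrite /s4 /s3 /= j0 gtn_eqF // fr2; last by lia.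
  by rewrite /s1 /= gtn_eqF //; lia.
have -> : eval_time (Var 0) s = tree_size (X i) by rewrite /= Hs addn0.
have -> : eval_time (Var 0) s2 = tree_size (Y i) by rewrite /= Y2 addn0.
have -> : eval_time (Var v) s3 = tree_size (X i).
  by rewrite /= ltn_eqF // fr2 // /s1 /= eqxx Hs addn0.
have -> : eval_time (ENode (Var v.+1) (Var 0)) s5 =
    (tree_size (Y i) + tree_size (Z i)).+1 + (tree_size (Y i) + tree_size (Z i)).
  by rewrite [eval_time _ _]/= s5v Y5 !addn0.
by move: (sY i) (sZ i); lia.
Qed.

Lemma ptime_if C Y Z : ptime X C -> ptime X Y -> ptime X Z ->
  ptime X (fun i => if is_node (C i) then Y i else Z i).
Proof.
move=> [p0 [m0 [b0 [bb0 sC H0]]]] [p [m [b [bb sY H]]]].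
move=> [p' [m' [b' [bb' sZ H']]]].
have [v [mv0 mv mv']] : exists v, [/\ m0 < v, m < v & m' < v].
  by exists (m0 + m + m').+1; split; lia.
exists (Seq (Assign v (Var 0)) (Seq p0 (Seq (Assign v.+1 (Var 0))
  (Seq (Assign 0 (Var v)) (If (Var v.+1) p p'))))).
exists v.+1.
exists (fun i => 20 + 5 * tree_size (X i) + 5 * b0 i + 5 * b i + 5 * b' i); split.
- by pbound_tac.
- by move=> i /=; move: (sY i) (sZ i); case: ifP => _; lia.
move=> i s Hs.
pose s1 := [eta s with v |-> eval (Var 0) s].
have s1E : s1 0 = X i by rewrite /s1 /= ltn_eqF //; lia.
have [t1 [s2 [E2 Y2 fr2 T2]]] := H0 i s1 s1E.
pose s3 := [eta s2 with v.+1 |-> eval (Var 0) s2].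
pose s4 := [eta s3 with 0 |-> eval (Var v) s3].
have s4E : s4 0 = X i.
  by rewrite /s4 /= ltn_eqF // fr2 // /s1 /= eqxx.
have s4v : s4 v.+1 = C i by rewrite /s4 /s3 /= eqxx.
have fr : forall j, v.+1 < j -> s4 j = s j.
  move=> j vj; have j0 : (j == 0) = false by case: j vj.
  rewrite /s4 /s3 /= j0 gtn_eqF // fr2; last by lia.
  by rewrite /s1 /= gtn_eqF //; lia.
have T1 : eval_time (Var 0) s = tree_size (X i) by rewrite /= Hs addn0.
have T3 : eval_time (Var 0) s2 = tree_size (C i) by rewrite /= Y2 addn0.
have T4 : eval_time (Var v) s3 = tree_size (X i).
  by rewrite /= ltn_eqF // fr2 // /s1 /= eqxx Hs addn0.
have T5 : eval_time (Var v.+1) s4 = tree_size (C i).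
  by rewrite -s4v /= addn0.
have [CN|CL] := boolP (is_node (C i)).
- have [t5 [s5 [E5 Y5 fr5 T6]]] := H i s4 s4E.
  eexists _, s5; split.
  + do !apply: ExecSeq; [exact: ExecAssign|exact: E2|exact: ExecAssign|
      exact: ExecAssign|apply: ExecIfTrue E5; by move: CN; rewrite -s4v].
  + by [].
  + by move=> j vj; rewrite fr5 ?fr //; lia.
  by rewrite T1 T3 T4 T5; move: (sC i); lia.
have [t5 [s5 [E5 Y5 fr5 T6]]] := H' i s4 s4E.
eexists _, s5; split.
- do !apply: ExecSeq; [exact: ExecAssign|exact: E2|exact: ExecAssign|
    exact: ExecAssign|apply: ExecIfFalse E5; by move: CL; rewrite -s4v].
- by [].
- by move=> j vj; rewrite fr5 ?fr //; lia.
by rewrite T1 T3 T4 T5; move: (sC i); lia.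
Qed.

End Combinators.

Lemma ptime_reindex I J (h : J -> I) (X Y : I -> tree) :
  ptime X Y -> ptime (fun j => X (h j)) (fun j => Y (h j)).
Proof.
move=> [p [m [b [bb bY H]]]]; exists p, m, (b \o h); split=> [|i|i s] /=.
- exact: pbound_reindex.
- exact: bY.
exact: H.
Qed.

Lemma ptime_left I (X Y : I -> tree) :
  ptime X Y -> ptime X (fun i => left_tree (Y i)).
Proof. by move=> pY; apply: ptime_trans pY (ptime_left0 _). Qed.

Lemma ptime_right I (X Y : I -> tree) :
  ptime X Y -> ptime X (fun i => right_tree (Y i)).
Proof. by move=> pY; apply: ptime_trans pY (ptime_right0 _). Qed.

Lemma ptime_fst I (X Y Z : I -> tree) :
  ptime X (fun i => Node (Y i) (Z i)) -> ptime X Y.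
Proof. exact: ptime_left. Qed.

Lemma ptime_snd I (X Y Z : I -> tree) :
  ptime X (fun i => Node (Y i) (Z i)) -> ptime X Z.
Proof. exact: ptime_right. Qed.

(* A moment in the fold over [L fp_idx].  Recording the whole list lets the loop
   body rely on properties of the part already processed. *)
Record fold_pos (I : Type) (T : I -> Type) (L : forall i, seq (T i)) := FoldPos {
  fp_idx : I;
  fp_pre : seq (T fp_idx);
  fp_elt : T fp_idx;
  fp_post : seq (T fp_idx);
  fp_eq : L fp_idx = fp_pre ++ fp_elt :: fp_post }.

(** * Bounded iteration over lists *)

Section Fold.
Variables (I : Type) (X : I -> tree) (T S : I -> Type).
Variables (eT : forall i, T i -> tree) (eS : forall i, S i -> tree).
Variables (L : forall i, seq (T i)) (s0 : forall i, S i).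
Variable step : forall i, S i -> T i -> S i.

Let fold i l := foldl (@step i) (s0 i) l.

Lemma enc_seq_size_mem i (l1 : seq (T i)) x l2 :
  tree_size (eT x) <= tree_size (enc_seq (map (@eT i) (l1 ++ x :: l2))).
Proof. by elim: l1 => /= [|y l1 IH]; lia. Qed.

Lemma size_enc_seq (l : seq tree) : size l <= tree_size (enc_seq l).
Proof. by elim: l => //= x l IH; lia. Qed.

Lemma enc_seq_cat_size (l1 l2 : seq tree) :
  tree_size (enc_seq l2) <= tree_size (enc_seq (l1 ++ l2)).
Proof. by elim: l1 => //= x l1 IH; lia. Qed.

(** A polynomial-time step may double its accumulator, and iterating it could then produce trees of
    exponential size. Hence the bound [b], in terms of the input of the whole loop, on the
    accumulators after all prefixes of the list. *)
Lemma ptime_foldl (b : I -> nat) :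
  ptime X (fun i => enc_seq (map (@eT i) (L i))) ->
  ptime X (fun i => eS (s0 i)) ->
  pbound X b ->
  (forall i l1 l2, L i = l1 ++ l2 -> tree_size (eS (fold l1)) <= b i) ->
  ptime (fun j : fold_pos L =>
           Node (X (fp_idx j)) (Node (eS (fold (fp_pre j))) (eT (fp_elt j))))
        (fun j => eS (step (fold (fp_pre j)) (fp_elt j))) ->
  ptime X (fun i => eS (fold (L i))).
Proof.
move=> [pL [mL [bL [bbL sL HL]]]] [p0 [m0 [b0 [bb0 sS HS]]]] bb sb.
move=> [pB [mB [bB [[c [k bbB]] sB HB]]]].
have [v [mvL mv0 mvB]] : exists v, [/\ mL < v, m0 < v & mB < v].
  by exists (mL + m0 + mB).+1; split; lia.
pose body := Seq (Assign 0 (ENode (Var v) (ENode (Var 0) (ELeft (Var v.+1)))))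
  (Seq pB (Assign v.+1 (ERight (Var v.+1)))).
(* [W] bounds the time of [pB], whose input joins the input of the loop, the accumulator and one
   element by two nodes, whence the 2; [D] bounds a whole iteration. *)
pose W i := c * (2 + tree_size (X i) + b i + bL i) ^ k.
pose D i := 20 + 5 * tree_size (X i) + 5 * b i + 10 * bL i + W i.
exists (Seq (Assign v (Var 0)) (Seq pL (Seq (Assign v.+1 (Var 0))
  (Seq (Assign 0 (Var v)) (Seq p0 (While (Var v.+1) body)))))).
exists v.+1.
exists (fun i => 20 + 5 * tree_size (X i) + 5 * bL i + 5 * b0 i + b i
         + (bL i).+1 * D i); split.
- have bW : pbound X W.
    by rewrite /W; pbound_tac.
  have bD : pbound X D by rewrite /D; pbound_tac.
  by pbound_tac.
- by move=> i; move: (sb i (L i) [::]); rewrite cats0 => /(_ erefl); lia.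
move=> i s Hs.
have loop : forall l2 l1 st, L i = l1 ++ l2 -> st v = X i ->
    st v.+1 = enc_seq (map (@eT i) l2) -> st 0 = eS (fold l1) ->
    exists t st', [/\ exec (While (Var v.+1) body) st t st',
      st' 0 = eS (fold (L i)), forall j, v.+1 < j -> st' j = st j
      & t <= (size l2).+1 * D i].
  elim=> [|x l2 IH] l1 st L12 stv stv1 st0.
    exists (eval_time (Var v.+1) st).+1, st; split=> //.
    - by apply: ExecWhileFalse; rewrite /= stv1.
    - by rewrite st0 L12 cats0.
    by rewrite /= stv1 /= /D; lia.
  pose s1 := [eta st with 0 |-> eval (ENode (Var v) (ENode (Var 0) (ELeft (Var
    v.+1)))) st].
  have E1 : exec (Assign 0 (ENode (Var v) (ENode (Var 0) (ELeft (Var v.+1))))) st _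
    s1 :=
    ExecAssign _ _ _.
  pose j := FoldPos L12.
  have s1j : s1 0 = Node (X (fp_idx j)) (Node (eS (fold (fp_pre j))) (eT (fp_elt j))).
    by rewrite /s1 /= stv st0 stv1.
  have [t2 [s2 [E2 Y2 fr2 T2]]] := HB j s1 s1j.
  have s2v : s2 v = X i.
    by rewrite fr2 // /s1 /= gtn_eqF ?stv //; apply: leq_ltn_trans mvL.
  have s2v1 : s2 v.+1 = enc_seq (map (@eT i) (x :: l2)).
    by rewrite fr2 ?(ltn_trans mvB) // /s1 /= stv1.
  pose s3 := [eta s2 with v.+1 |-> eval (ERight (Var v.+1)) s2].
  have L12' : L i = rcons l1 x ++ l2 by rewrite cat_rcons.
  have [||| t4 [s4 [E4 Y4 fr4 T4]]] := IH (rcons l1 x) s3 L12'.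
  - by rewrite /s3 /= ltn_eqF.
  - by rewrite /s3 /= eqxx s2v1.
  - by rewrite /s3 /= Y2 /fold foldl_rcons.
  eexists _, s4; split.
  - apply: ExecWhileTrue E4; first by rewrite /= stv1.
    by apply: ExecSeq E1 _; apply: ExecSeq E2 _; apply: ExecAssign.
  - by [].
  - move=> n vn; have n0 : (n == 0) = false by case: n vn.
    rewrite fr4 // /s3 /= gtn_eqF // fr2; last by lia.
    by rewrite /s1 /= n0.
  have szl : tree_size (enc_seq (map (@eT i) (x :: l2))) <= bL i.
    by apply: leq_trans (sL i); rewrite L12 map_cat enc_seq_cat_size.
  have szf : tree_size (eS (fold l1)) <= b i by apply: sb L12.
  have T2' : t2 <= W i.
    apply: leq_trans T2 _; apply: leq_trans (bbB _) _.
    rewrite /W leq_mul2l; apply/orP; right.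
    have := szl; rewrite /= => szl'.
    by case: (k) => [|k'] //; rewrite leq_exp2r //; lia.
  have T1' : eval_time (Var v.+1) st <= bL i by rewrite /= stv1 addn0.
  have T2'' : eval_time (ENode (Var v) (ENode (Var 0) (ELeft (Var v.+1)))) st
     <= 3 + 2 * tree_size (X i) + 3 * b i + 4 * bL i.
    by rewrite /= stv st0 stv1 /=; move: szl => /=; lia.
  have T3' : eval_time (ERight (Var v.+1)) s2 <= 2 * bL i.
    by rewrite /= s2v1 /=; move: szl => /=; lia.
  have -> : (size (x :: l2)).+1 * D i = (size l2).+1 * D i + D i by rewrite /= mulSnr.
  suff: ((eval_time (Var v.+1) st + ((eval_time
    (ENode (Var v) (ENode (Var 0) (ELeft (Var v.+1)))) st).+1 +
     (t2 + (eval_time (ERight (Var v.+1)) s2).+1).+1).+1)).+1 <= D i by lia.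
  by rewrite /D; lia.
pose s1 := [eta s with v |-> eval (Var 0) s].
have s1E : s1 0 = X i by rewrite /s1 /= ltn_eqF //; lia.
have [t1 [s2 [E2 Y2 fr2 T2]]] := HL i s1 s1E.
pose s3 := [eta s2 with v.+1 |-> eval (Var 0) s2].
pose s4 := [eta s3 with 0 |-> eval (Var v) s3].
have s4E : s4 0 = X i.
  by rewrite /s4 /= ltn_eqF // fr2 // /s1 /= eqxx.
have [t5 [s5 [E5 Y5 fr5 T5]]] := HS i s4 s4E.
have s5v : s5 v = X i.
  rewrite fr5 // /s4 /= gtn_eqF; last exact: leq_ltn_trans mvL.
  by rewrite ltn_eqF // fr2 // /s1 /= eqxx.
have s5v1 : s5 v.+1 = enc_seq (map (@eT i) (L i)).
  by rewrite fr5 ?(ltn_trans mv0) // /s4 /s3 /= eqxx.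
have [t6 [s6 [E6 Y6 fr6 T6]]] := loop (L i) [::] s5 erefl s5v s5v1 Y5.
eexists _, s6; split.
- do !apply: ExecSeq; [exact: ExecAssign|exact: E2|exact: ExecAssign|
    exact: ExecAssign|exact: E5|exact: E6].
- by [].
- move=> j vj; have j0 : (j == 0) = false by case: j vj.
  rewrite fr6 // fr5; last by lia.
  rewrite /s4 /s3 /= j0 gtn_eqF // fr2; last by lia.
  by rewrite /s1 /= gtn_eqF //; lia.
have -> : eval_time (Var 0) s = tree_size (X i) by rewrite /= Hs addn0.
have -> : eval_time (Var 0) s2 = tree_size (enc_seq (map (@eT i) (L i))).
  by rewrite /= Y2 addn0.
have -> : eval_time (Var v) s3 = tree_size (X i).
  by rewrite /= ltn_eqF // fr2 // /s1 /= eqxx Hs addn0.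
have szL : size (L i) <= bL i.
  by apply: leq_trans (sL i); rewrite -(size_map (@eT i)) size_enc_seq.
have T6' : t6 <= (bL i).+1 * D i.
  by apply: leq_trans T6 _; rewrite leq_mul2r ltnS szL orbT.
by move: (sL i) (sS i); lia.
Qed.

End Fold.

Lemma tree_size_enc_seq (l : seq tree) :
  tree_size (enc_seq l) = (sumn (map tree_size l) + size l).+1.
Proof. by elim: l => //= x l ->; lia. Qed.

(** Nested nodes act as an environment: a loop or quantifier pairs the current input with its bound
    element, and whatever was computable before remains so by forgetting the right component. *)
Lemma ptime_weak I (T : I -> Type) (X Y : I -> tree) (eT : forall i, T i -> tree) :
  ptime X Y ->
  ptime (fun j : {i & T i} => Node (X (tag j)) (eT _ (tagged j)))
        (fun j => Y (tag j)).
Proof.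
move=> /(ptime_reindex (@tag I T)) H; apply: ptime_trans _ H.
exact: ptime_fst (ptime_id _).
Qed.

Lemma ptime_tagged I (T : I -> Type) (X : I -> tree) (eT : forall i, T i -> tree) :
  ptime (fun j : {i & T i} => Node (X (tag j)) (eT _ (tagged j)))
        (fun j => eT _ (tagged j)).
Proof. exact: ptime_snd (ptime_id _). Qed.

Section FoldInv.
Variables (I : Type) (X : I -> tree) (T S : I -> Type).
Variables (eT : forall i, T i -> tree) (eS : forall i, S i -> tree).
Variables (L : forall i, seq (T i)) (s0 : forall i, S i).
Variables (step : forall i, S i -> T i -> S i) (Inv : forall i, S i -> Prop).

(** The history of the loop is replaced by an invariant: the body is indexed by arbitrary states
    satisfying [Inv], and the size bound has to follow from [Inv] alone. *)
Lemma ptime_foldl_inv (b : I -> nat) :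
  ptime X (fun i => enc_seq (map (@eT i) (L i))) ->
  ptime X (fun i => eS (s0 i)) ->
  pbound X b ->
  (forall i, Inv (s0 i)) ->
  (forall i s x, Inv s -> Inv (@step i s x)) ->
  (forall i s, Inv s -> tree_size (@eS i s) <= b i) ->
  ptime (fun j : {j : {i & {s : S i | Inv s}} & T (tag j)} =>
           Node (Node (X (tag (tag j))) (eS (sval (tagged (tag j)))))
                (eT (tagged j)))
        (fun j => eS (step (sval (tagged (tag j))) (tagged j))) ->
  ptime X (fun i => eS (foldl (@step i) (s0 i) (L i))).
Proof.
move=> hL hs bb I0 Is Ib body.
have If i l : Inv (foldl (@step i) (s0 i) l).
  elim/last_ind: l => [|l x IH] /=; first exact: I0.
  by rewrite foldl_rcons; apply: Is.
apply: (ptime_foldl (eT := eT) (eS := eS) (b := b)) => // [i l1 l2 _|]; first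
  exact: Ib.
pose h (j : fold_pos L) : {j : {i & {s : S i | Inv s}} & T (tag j)} :=
  existT (fun j : {i & {s : S i | Inv s}} => T (tag j))
    (existT (fun i => {s : S i | Inv s}) (fp_idx j)
      (exist (@Inv (fp_idx j)) _ (If _ (fp_pre j)))) (fp_elt j).
apply: ptime_trans _ (ptime_reindex h body).
have id := ptime_id (fun j : fold_pos L => Node (X (fp_idx j))
  (Node (eS (foldl (@step _) (s0 _) (fp_pre j))) (eT (fp_elt j)))).
apply: ptime_node; last exact: ptime_snd (ptime_snd id).
apply: ptime_node; first exact: ptime_fst id.
exact: ptime_fst (ptime_snd id).
Qed.

End FoldInv.

(** * List operations and Boolean connectives *)

Section Lists.
Variables (I : Type) (X : I -> tree).

Lemma ptime_rev (l : I -> seq tree) :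
  ptime X (fun i => enc_seq (l i)) -> ptime X (fun i => enc_seq (rev (l i))).
Proof.
move=> hl.
have foldE (s : seq tree) : foldl (fun acc x => x :: acc) [::] s = rev s.
  by rewrite /rev; elim: s [::] => //= x s IH acc; rewrite IH.
suff: ptime X (fun i => enc_seq (foldl (fun acc x => x :: acc) [::] (l i))).
  by move/eq_ptime; apply=> i; rewrite foldE.
pose b i := tree_size (enc_seq (l i)).
apply: (ptime_foldl (S := fun=> seq tree) (eS := fun=> enc_seq)
  (s0 := fun=> [::]) (eT := fun=> id) (b := b) (step := fun i acc x => x :: acc)).
- by apply: eq_ptime hl _ => i; rewrite map_id.
- exact: (ptime_leaf X).
- exact: ptime_size hl.
- move=> i l1 l2 E; rewrite foldE /b E !tree_size_enc_seq map_rev sumn_rev.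
  by rewrite size_rev map_cat sumn_cat size_cat; lia.
set C := fun j : fold_pos _ => _; have id := ptime_id C.
by apply: ptime_node (ptime_snd (ptime_snd id)) (ptime_fst (ptime_snd id)).
Qed.

Lemma ptime_map (T : I -> Type) (eT : forall i, T i -> tree)
    (L : forall i, seq (T i)) (f : forall i, T i -> tree) :
  ptime X (fun i => enc_seq (map (@eT i) (L i))) ->
  ptime (fun j : {i & T i} => Node (X (tag j)) (eT _ (tagged j)))
        (fun j => f _ (tagged j)) ->
  ptime X (fun i => enc_seq (map (@f i) (L i))).
Proof.
move=> hL hf.
have foldE i (s : seq (T i)) : foldl (fun acc x => f i x :: acc) [::] s = rev (map
  (@f i) s).
  by rewrite /rev; elim: s [::] => //= x s IH acc; rewrite IH.
suff: ptime X (fun i => enc_seq (foldl (fun acc x => f i x :: acc) [::] (L i))).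
  by move/ptime_rev/eq_ptime; apply=> i; rewrite foldE revK.
have [c [k Hf]] := ptime_size hf.
pose m i := tree_size (enc_seq (map (@eT i) (L i))).
pose b i := (m i * (c * (tree_size (X i) + m i).+1 ^ k).+1).+1.
apply: (ptime_foldl (S := fun=> seq tree) (eS := fun=> enc_seq)
  (s0 := fun=> [::]) (eT := eT) (b := b) (step := fun i acc x => f i x :: acc)) => //.
- exact: (ptime_leaf X).
- have bm : pbound X m := ptime_size hL.
  by rewrite /b; pbound_tac.
- move=> i l1 l2 E; rewrite foldE tree_size_enc_seq map_rev sumn_rev size_rev /b ltnS.
  have sz1 : size l1 <= m i.
    apply: leq_trans (size_enc_seq _); rewrite size_map E size_cat; exact: leq_addr.
  apply: leq_trans (leq_mul sz1 (leqnn _)).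
  rewrite mulnS size_map addnC leq_add2l.
  (* Every value is bounded through the code of the whole list, so the induction on [l1] keeps the
     part [l] already passed. *)
  suff H l l' : L i = l ++ l1 ++ l' ->
      sumn [seq tree_size j | j <- [seq f i i0 | i0 <- l1]] <=
      size l1 * (c * (tree_size (X i) + m i).+1 ^ k) by apply: (H [::] l2).
  elim: l1 l {sz1 E} => //= x l1 IH l E; rewrite mulSn leq_add //; last first.
    by apply: (IH (rcons l x)); rewrite cat_rcons.
  apply: leq_trans (Hf (Tagged T x)) _; rewrite leq_mul2l; apply/orP; right.
  case: (k) => // k'; rewrite leq_exp2r //= ltnS leq_add2l /m E.
  exact: enc_seq_size_mem.
set C := fun j : fold_pos _ => _; have id := ptime_id C.
apply: ptime_node; last exact: ptime_fst (ptime_snd id).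
pose h (j : fold_pos L) : {i & T i} := Tagged T (fp_elt j).
apply: ptime_trans _ (ptime_reindex h hf).
by apply: ptime_node (ptime_fst id) (ptime_snd (ptime_snd id)).
Qed.

Lemma ptime_if_bool (c : I -> bool) (Y Z : I -> tree) :
  ptime X (fun i => enc_bool (c i)) -> ptime X Y -> ptime X Z ->
  ptime X (fun i => if c i then Y i else Z i).
Proof.
by move=> hc hY hZ; apply: eq_ptime (ptime_if hc hY hZ) _ => i; case: (c i).
Qed.

Lemma ptime_const t : ptime X (fun=> t).
Proof.
by elim: t => [|l hl r hr]; [apply: ptime_leaf | apply: ptime_node].
Qed.

Lemma ptime_is_node (Y : I -> tree) :
  ptime X Y -> ptime X (fun i => enc_bool (is_node (Y i))).
Proof.
move=> hY; have := ptime_if hY (ptime_const (enc_bool true)) (ptime_const Leaf).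
by move/eq_ptime; apply=> i; case: (is_node _).
Qed.

Lemma ptime_neg (c : I -> bool) :
  ptime X (fun i => enc_bool (c i)) -> ptime X (fun i => enc_bool (~~ c i)).
Proof.
move=> hc; have := ptime_if_bool hc (ptime_leaf X) (ptime_const (enc_bool true)).
by move/eq_ptime; apply=> i; case: (c i).
Qed.

Lemma ptime_and (c d : I -> bool) :
  ptime X (fun i => enc_bool (c i)) -> ptime X (fun i => enc_bool (d i)) ->
  ptime X (fun i => enc_bool (c i && d i)).
Proof.
move=> hc hd; have := ptime_if_bool hc hd (ptime_leaf X).
by move/eq_ptime; apply=> i; case: (c i).
Qed.

Lemma ptime_or (c d : I -> bool) :
  ptime X (fun i => enc_bool (c i)) -> ptime X (fun i => enc_bool (d i)) ->
  ptime X (fun i => enc_bool (c i || d i)).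
Proof.
move=> hc hd; have := ptime_if_bool hc (ptime_const (enc_bool true)) hd.
by move/eq_ptime; apply=> i; case: (c i).
Qed.

Lemma ptime_addb (c d : I -> bool) :
  ptime X (fun i => enc_bool (c i)) -> ptime X (fun i => enc_bool (d i)) ->
  ptime X (fun i => enc_bool (c i (+) d i)).
Proof.
move=> hc hd; have := ptime_if_bool hc (ptime_neg hd) hd.
by move/eq_ptime; apply=> i; case: (c i); case: (d i).
Qed.

End Lists.

Lemma ptime_has (I : Type) (X : I -> tree) (T : I -> Type) (L : forall i, seq (T
  i)) (c : forall i, T i -> bool) :
  ptime X (fun i => enc_seq [seq enc_bool (c i x) | x <- L i]) ->
  ptime X (fun i => enc_bool (has (c i) (L i))).
Proof.
move=> hL.
have foldE i l : foldl (fun acc x => acc || c i x) false l = has (c i) l.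
  rewrite -[has _ _]orFb; elim: l false => [|x l IH] acc /=; first by rewrite orbF.
  by rewrite IH orbA.
suff: ptime X (fun i => enc_bool (foldl (fun acc x => acc || c i x) false (L i))).
  by move/eq_ptime; apply=> i; rewrite foldE.
apply: (ptime_foldl (S := fun=> bool) (eS := fun=> enc_bool) (s0 := fun=> false)
  (b := fun=> 3) (step := fun i acc x => acc || c i x) hL).
- exact: (ptime_leaf X).
- exact: pbound_const.
- by move=> i l1 l2 _; case: foldl.
set C := fun j : fold_pos _ => _; have id := ptime_id C.
apply: ptime_or; first exact: ptime_fst (ptime_snd id).
exact: ptime_snd (ptime_snd id).
Qed.

(** * Unary positions and tables indexed by vertices *)

Definition enc_unary (n : nat) : tree := enc_seq (nseq n Leaf).

Lemma tree_size_unary n : tree_size (enc_unary n) = n.*2.+1.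
Proof. by rewrite /enc_unary; elim: n => //= n ->; lia. Qed.

Section Unary.
Variables (I : Type) (X : I -> tree).

(** With positions in unary, dropping [n] entries is a fold over the code of [n] itself. *)
Lemma ptime_drop (n : I -> nat) (l : I -> seq tree) :
  ptime X (fun i => enc_unary (n i)) -> ptime X (fun i => enc_seq (l i)) ->
  ptime X (fun i => enc_seq (drop (n i) (l i))).
Proof.
move=> hn hl.
have foldE (r : seq tree) (s : seq tree) :
    foldl (fun acc (_ : tree) => behead acc) r s = drop (size s) r.
  elim: s r => [|x s IH] r /=; first by rewrite drop0.
  by rewrite IH; case: r.
suff: ptime X (fun i => enc_seq (foldl (fun acc (_ : tree) => behead acc) (l i)
    (nseq (n i) Leaf))).
  by move/eq_ptime; apply=> i; rewrite foldE size_nseq.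
apply: (ptime_foldl (S := fun=> seq tree) (eS := fun=> enc_seq) (s0 := l)
  (eT := fun=> id) (L := fun i => nseq (n i) Leaf)
  (b := fun i => tree_size (enc_seq (l i))) (step := fun i acc _ => behead acc)).
- by apply: eq_ptime hn _ => i; rewrite map_id.
- exact: hl.
- exact: ptime_size hl.
- move=> i l1 l2 _; rewrite foldE !tree_size_enc_seq -{3 4}(cat_take_drop (size l1)
  (l i)).
  by rewrite map_cat sumn_cat size_cat; lia.
set C := fun j : fold_pos _ => _; have id := ptime_id C.
apply: (eq_ptime (ptime_right (ptime_fst (ptime_snd id)))) => j.
by case: foldl.
Qed.

Lemma ptime_nth (n : I -> nat) (l : I -> seq tree) :
  ptime X (fun i => enc_unary (n i)) -> ptime X (fun i => enc_seq (l i)) ->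
  ptime X (fun i => nth Leaf (l i) (n i)).
Proof.
move=> hn hl; apply: eq_ptime (ptime_left (ptime_drop hn hl)) _ => i.
by rewrite -[n i in RHS]addn0 -nth_drop; case: drop.
Qed.

Lemma ptime_unary_lt (m n : I -> nat) :
  ptime X (fun i => enc_unary (m i)) -> ptime X (fun i => enc_unary (n i)) ->
  ptime X (fun i => enc_bool (m i < n i)).
Proof.
move=> hm hn; apply: eq_ptime (ptime_is_node (ptime_drop hm hn)) _ => i.
by rewrite drop_nseq -subn_gt0; case: (_ - _).
Qed.

Lemma ptime_unary_eq (m n : I -> nat) :
  ptime X (fun i => enc_unary (m i)) -> ptime X (fun i => enc_unary (n i)) ->
  ptime X (fun i => enc_bool (m i == n i)).
Proof.
move=> hm hn.
apply: eq_ptime (ptime_and (ptime_neg (ptime_unary_lt hm hn))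
  (ptime_neg (ptime_unary_lt hn hm))) _ => i.
by rewrite -!leqNgt eqn_leq andbC.
Qed.

(** The state is a counter [n], but it is encoded as the decreasing list of all unary numbers below
    [n]; the next entry is one longer than the head. *)
Lemma ptime_unary_iota (l : I -> seq tree) :
  ptime X (fun i => enc_seq (l i)) ->
  ptime X (fun i => enc_seq (map enc_unary (iota 0 (size (l i))))).
Proof.
move=> hl; pose e (_ : I) n := enc_seq (map enc_unary (rev (iota 0 n))).
have foldE (s : seq tree) : foldl (fun n (_ : tree) => n.+1) 0 s = size s.
  by rewrite -[size s]addn0; elim: s 0 => //= x s IH n; rewrite IH addnS.
suff: ptime X (fun i => e i (foldl (fun n _ => n.+1) 0 (l i))).
  by move/ptime_rev/eq_ptime; apply=> i; rewrite foldE -map_rev revK.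
pose b i := (tree_size (enc_seq (l i)) ^ 2 * 2 + 1).
apply: (ptime_foldl (S := fun=> nat) (eS := e) (s0 := fun=> 0)
  (eT := fun=> id) (b := b) (step := fun i n _ => n.+1)).
- by apply: eq_ptime hl _ => i; rewrite map_id.
- exact: ptime_leaf.
- have := ptime_size hl; by rewrite /b => ?; pbound_tac.
- move=> i l1 l2 E; rewrite foldE /e /b.
  have : size l1 <= (sumn [seq tree_size j | j <- l i] + size (l i)).
    by rewrite E size_cat; lia.
  rewrite !tree_size_enc_seq; set m := (sumn _ + size (l i)) => H.
  (* The codes have sizes 1, 3, 5, ..., which add up to a square. *)
  have -> : sumn [seq tree_size j | j <- [seq enc_unary i | i <- rev (iota 0 (size
    l1))]]
     = (size l1) ^ 2.
    rewrite -map_comp map_rev sumn_rev.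
    elim: (size l1) => // n IH; rewrite -addn1 iotaD map_cat sumn_cat IH /=.
    by rewrite tree_size_unary; lia.
  rewrite size_map size_rev size_iota.
  by have := leq_mul H H; lia.
set C := fun j : fold_pos _ => _; have id := ptime_id C.
have h := ptime_fst (ptime_snd id).
apply: eq_ptime (ptime_if h (ptime_node (ptime_node (ptime_leaf _) (ptime_left h)) h)
  (ptime_node (ptime_leaf _) (ptime_leaf _))) _ => j.
have rI n : rev (iota 0 n.+1) = n :: rev (iota 0 n).
  by rewrite -addn1 iotaD rev_cat.
by rewrite /C /e; case: (foldl _ _ _) => // n; rewrite !rI.
Qed.

End Unary.

(** [enum V] also orders the rows, columns and weights of the input, so evaluating a tabulated
    function at a vertex is list access. *)
Definition enc_vertex (V : finType) (v : V) : tree := enc_unary (enum_rank v).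

Definition enc_fun (V : finType) (f : V -> tree) : tree :=
  enc_seq [seq f v | v <- enum V].

Definition enc_set (V : finType) (A : {set V}) : tree :=
  enc_fun (fun v => enc_bool (v \in A)).

Section Tables.
Variables (I : Type) (V : I -> finType) (X : I -> tree).

Lemma ptime_lookup (f : forall i, V i -> tree) (v : forall i, V i) :
  ptime X (fun i => enc_fun (f i)) -> ptime X (fun i => enc_vertex (v i)) ->
  ptime X (fun i => f i (v i)).
Proof.
move=> hf hv; apply: eq_ptime (ptime_nth hv hf) _ => i.
by rewrite (nth_map (v i)) ?nth_enum_rank // -cardE ltn_ord.
Qed.

Lemma ptime_in (A : forall i, {set V i}) (v : forall i, V i) :
  ptime X (fun i => enc_set (A i)) -> ptime X (fun i => enc_vertex (v i)) ->
  ptime X (fun i => enc_bool (v i \in A i)).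
Proof. exact: (@ptime_lookup (fun i v => enc_bool (v \in A i))). Qed.

Lemma ptime_vertex_eq (x y : forall i, V i) :
  ptime X (fun i => enc_vertex (x i)) -> ptime X (fun i => enc_vertex (y i)) ->
  ptime X (fun i => enc_bool (x i == y i)).
Proof.
move=> hx hy; apply: eq_ptime (ptime_unary_eq hx hy) _ => i.
by rewrite (inj_eq val_inj) (inj_eq enum_rank_inj).
Qed.

(** The input does not list the vertices; their codes are recovered from the length of any table
    over them. *)
Lemma ptime_enum (f : forall i, V i -> tree) :
  ptime X (fun i => enc_fun (f i)) -> ptime X (fun i => enc_fun (@enc_vertex (V i))).
Proof.
move=> /ptime_unary_iota /eq_ptime; apply=> i; congr enc_seq.
transitivity (map enc_unary [seq val (enum_rank v) | v <- enum (V i)]); last first.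
  by rewrite -map_comp.
rewrite size_map; congr map.
apply: (@eq_from_nth _ 0) => [|k]; first by rewrite size_iota size_map.
rewrite size_iota -cardE => lk; have [v vk] : exists v : V i, val (enum_rank v) = k.
  by exists (enum_val (Ordinal lk)); rewrite enum_valK.
by rewrite nth_iota // (nth_map v) -?cardE // -vk nth_enum_rank.
Qed.

Hypothesis hV : ptime X (fun i => enc_fun (@enc_vertex (V i))).

Lemma ptime_tab (f : forall i, V i -> tree) :
  ptime (fun j : {i & V i} => Node (X (tag j)) (enc_vertex (tagged j)))
        (fun j => f _ (tagged j)) ->
  ptime X (fun i => enc_fun (f i)).
Proof. exact: (ptime_map (L := fun i => enum (V i)) hV). Qed.

Lemma ptime_set (P : forall i, V i -> bool) :
  ptime (fun j : {i & V i} => Node (X (tag j)) (enc_vertex (tagged j)))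
        (fun j => enc_bool (P _ (tagged j))) ->
  ptime X (fun i => enc_set [set v | P i v]).
Proof.
move=> hP; apply: eq_ptime (ptime_tab (f := fun i v => enc_bool (P i v)) hP) _ => i.
by congr enc_seq; apply: eq_map => v; rewrite inE.
Qed.

Lemma ptime_exists (P : forall i, V i -> bool) :
  ptime (fun j : {i & V i} => Node (X (tag j)) (enc_vertex (tagged j)))
        (fun j => enc_bool (P _ (tagged j))) ->
  ptime X (fun i => enc_bool [exists v, P i v]).
Proof.
move=> hP; have := ptime_tab (f := fun i v => enc_bool (P i v)) hP.
move/ptime_has/eq_ptime; apply=> i; congr enc_bool.
by apply/hasP/existsP => [[v _]|[v]]; exists v; rewrite ?mem_enum.
Qed.

Lemma ptime_forall (P : forall i, V i -> bool) :
  ptime (fun j : {i & V i} => Node (X (tag j)) (enc_vertex (tagged j)))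
        (fun j => enc_bool (P _ (tagged j))) ->
  ptime X (fun i => enc_bool [forall v, P i v]).
Proof.
move=> /ptime_neg hP; apply: eq_ptime (ptime_neg (ptime_exists (P := fun i v => ~~
  P i v) hP)) _ => i.
by rewrite negb_exists; congr enc_bool; apply: eq_forallb => v; rewrite negbK.
Qed.

End Tables.

(** * Binary arithmetic *)

Lemma size_bits n : size (bits n) = up_log 2 n.+1.
Proof. by rewrite size_mkseq. Qed.

Lemma size_bits_le n e : (size (bits n) <= e) = (n < 2 ^ e).
Proof.
rewrite size_bits; apply/idP/idP => [le|lt]; last exact: up_log_min.
by apply: leq_trans (leq_pexp2l _ le) => //; apply: up_logP.
Qed.

Lemma nth_bits n k : nth false (bits n) k = odd (n %/ 2 ^ k).
Proof.
have [lt|ge] := ltnP k (size (bits n)); first by rewrite nth_mkseq // -size_bits.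
by rewrite nth_default // divn_small // -size_bits_le.
Qed.

Lemma size_bits_double (b : bool) n : 0 < b + n.*2 -> size (bits (b + n.*2)) =
  (size (bits n)).+1.
Proof.
move=> pos; have H : n < 2 ^ size (bits n) by rewrite -size_bits_le.
apply/eqP; rewrite eqn_leq size_bits_le expnS; apply/andP; split.
  by case: b {pos} => /=; lia.
have : b + n.*2 < 2 ^ size (bits (b + n.*2)) by rewrite -size_bits_le.
case: (size (bits (b + n.*2))) => [|e]; first by rewrite expn0; lia.
by rewrite expnS ltnS size_bits_le; case: b {pos} => /=; lia.
Qed.

Lemma bits_double (b : bool) n : 0 < b + n.*2 -> bits (b + n.*2) = b :: bits n.
Proof.
move=> pos; apply: (@eq_from_nth _ false) => [|k _]; first by rewrite
  size_bits_double.
rewrite nth_bits; case: k => [|k] /=.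
  by rewrite divn1 oddD odd_double addbF; case: b {pos}.
rewrite nth_bits expnS divnMA; congr (odd (_ %/ _)).
by rewrite divn2 half_bit_double.
Qed.

Lemma enc_nat0 : enc_nat 0 = Leaf.
Proof. by rewrite /enc_nat (size0nil (s := bits 0)) // size_bits up_log1. Qed.

Lemma enc_nat_double (b : bool) n : 0 < b + n.*2 ->
  enc_nat (b + n.*2) = Node (enc_bool b) (enc_nat n).
Proof. by move=> pos; rewrite /enc_nat bits_double. Qed.

Lemma is_node_enc_nat n : is_node (enc_nat n) = (0 < n).
Proof.
case: (posnP n) => [->|pos]; first by rewrite enc_nat0.
by rewrite -[n]odd_double_half enc_nat_double ?odd_double_half.
Qed.

(** A digit costs at most 3 for itself and 1 for its list node; the final leaf costs 1. *)
Lemma enc_nat_size_le n e : n < 2 ^ e -> tree_size (enc_nat n) <= 4 * e + 1.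
Proof.
rewrite -size_bits_le => le; apply: leq_trans (_ : 4 * size (bits n) + 1 <= _);
  last by lia.
rewrite /enc_nat; elim: (bits n) => // b l IH /=.
by case: b => /=; lia.
Qed.

Lemma size_bits_size n : size (bits n) <= tree_size (enc_nat n).
Proof. by rewrite -(size_map enc_bool) size_enc_seq. Qed.

Lemma enc_nat_size_lt n : n < 2 ^ tree_size (enc_nat n).
Proof. by rewrite -size_bits_le size_bits_size. Qed.

(** The digit 1 is larger than the digit 0, so sizes are monotone only up to a factor: the code of 8
    is smaller than that of 7. *)
Lemma enc_nat_size_mono m n : m <= n -> tree_size (enc_nat m) <= 4 * tree_size
  (enc_nat n) + 1.
Proof. by move=> le; apply/enc_nat_size_le/(leq_ltn_trans le)/enc_nat_size_lt. Qed.

Lemma enc_nat_size_add m n :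
  tree_size (enc_nat (m + n)) <= 4 * (tree_size (enc_nat m) + tree_size (enc_nat
    n)) + 1.
Proof.
apply: enc_nat_size_le; have := (enc_nat_size_lt m, enc_nat_size_lt n).
rewrite expnD; set x := 2 ^ _; set y := 2 ^ _ => -[/= ? ?].
by have := tree_size_gt0 (enc_nat m); nia.
Qed.

Lemma enc_nat_size_mul m n :
  tree_size (enc_nat (m * n)) <= 4 * (tree_size (enc_nat m) + tree_size (enc_nat
    n)) + 1.
Proof.
apply: enc_nat_size_le; have := (enc_nat_size_lt m, enc_nat_size_lt n).
by rewrite expnD; set x := 2 ^ _; set y := 2 ^ _ => -[/= ? ?]; nia.
Qed.

Section NatBasics.
Variables (I : Type) (X : I -> tree).

Lemma ptime_pos (n : I -> nat) :
  ptime X (fun i => enc_nat (n i)) -> ptime X (fun i => enc_bool (0 < n i)).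
Proof. by move=> /ptime_is_node/eq_ptime; apply=> i; rewrite is_node_enc_nat. Qed.

(** The test avoids leading zeros: appending the digit 0 to the number 0 must give [Leaf]. *)
Lemma ptime_double (b : I -> bool) (n : I -> nat) :
  ptime X (fun i => enc_bool (b i)) -> ptime X (fun i => enc_nat (n i)) ->
  ptime X (fun i => enc_nat (b i + (n i).*2)).
Proof.
move=> hb hn; have := ptime_if_bool (ptime_or hb (ptime_pos hn)) (ptime_node hb hn)
  (ptime_leaf _).
move/eq_ptime; apply=> i; case: ifP => [pos|].
  by rewrite enc_nat_double //; move: pos; case: (b i) => /=; lia.
by case: (b i) => //=; case: (n i) => //=; rewrite enc_nat0.
Qed.

Lemma ptime_cat (l r : I -> seq tree) :
  ptime X (fun i => enc_seq (l i)) -> ptime X (fun i => enc_seq (r i)) ->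
  ptime X (fun i => enc_seq (l i ++ r i)).
Proof.
move=> /ptime_rev hl hr.
have foldE (s t : seq tree) : foldl (fun acc x => x :: acc) t s = catrev s t.
  by elim: s t => //= x s IH t; rewrite IH.
suff: ptime X (fun i => enc_seq (foldl (fun acc x => x :: acc) (r i) (rev (l i)))).
  by move/eq_ptime; apply=> i; rewrite foldE catrevE revK.
pose b i := (tree_size (enc_seq (rev (l i))) + tree_size (enc_seq (r i))).
apply: (ptime_foldl (S := fun=> seq tree) (eS := fun=> enc_seq)
  (s0 := r) (eT := fun=> id) (b := b) (step := fun i acc x => x :: acc)).
- by apply: eq_ptime hl _ => i; rewrite map_id.
- exact: hr.
- by have := ptime_size hl; have := ptime_size hr; rewrite /b => ? ?; pbound_tac.
- move=> i l1 l2 E; rewrite foldE catrevE /b E !tree_size_enc_seq !map_cat map_rev.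
  by rewrite !sumn_cat sumn_rev !size_cat size_rev; lia.
set C := fun j : fold_pos _ => _; have id := ptime_id C.
by apply: ptime_node (ptime_snd (ptime_snd id)) (ptime_fst (ptime_snd id)).
Qed.

End NatBasics.

Definition of_bits (l : seq bool) := foldl (fun n (b : bool) => b + n.*2) 0 l.

Lemma of_bits_cat_le l1 l2 : of_bits l1 <= of_bits (l1 ++ l2).
Proof.
rewrite /of_bits foldl_cat; elim: l2 (foldl _ 0 l1) => //= b l2 IH n.
by apply: leq_trans (IH _); case: b; lia.
Qed.

Lemma of_bits_iota n j m : n < 2 ^ (j + m) ->
  of_bits (rev [seq odd (n %/ 2 ^ k) | k <- iota j m]) = n %/ 2 ^ j.
Proof.
elim: m j => [|m IH] j; first by rewrite addn0 => lt; rewrite divn_small.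
rewrite -addSnnS => lt; rewrite /= rev_cons /of_bits foldl_rcons -/(of_bits _) IH //.
by rewrite expnSr divnMA divn2 odd_double_half.
Qed.

Lemma of_bits_rev_bits n : of_bits (rev (bits n)) = n.
Proof. by rewrite /bits /mkseq of_bits_iota ?divn1 //; apply: up_logP. Qed.

(** * Bounded recursion on binary notation *)

Section BinaryRecursion.
Variables (I : Type) (X : I -> tree).

(** Cobham's bounded recursion on notation, run from the most significant digit. The intermediate
    arguments are the leading parts of [a i], hence at most [a i], which is where the bound is
    required. *)
Lemma ptime_bitrec (a : I -> nat) (e : I -> nat -> tree) (b : I -> nat) :
  ptime X (fun i => enc_nat (a i)) -> ptime X (fun i => e i 0) ->
  pbound X b -> (forall i n, n <= a i -> tree_size (e i n) <= b i) ->
  ptime (fun j : I * nat * bool => Node (Node (X j.1.1) (e j.1.1 j.1.2)) (enc_bool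
    j.2))
        (fun j => e j.1.1 (j.2 + j.1.2.*2)) ->
  ptime X (fun i => e i (a i)).
Proof.
move=> /ptime_rev ha h0 bb sb hs.
suff: ptime X (fun i => e i (of_bits (rev (bits (a i))))).
  by move/eq_ptime; apply=> i; rewrite of_bits_rev_bits.
apply: (ptime_foldl (S := fun=> nat) (eS := e) (s0 := fun=> 0) (eT := fun=> enc_bool)
  (L := fun i => rev (bits (a i))) (step := fun i n (b : bool) => b + n.*2) (b :=
    b)) => //.
- by apply: eq_ptime ha _ => i; rewrite map_rev.
- move=> i l1 l2 E; apply: sb; rewrite -/(of_bits _) -[a i]of_bits_rev_bits E.
  exact: of_bits_cat_le.
set C := fun j : fold_pos _ => _; have id := ptime_id C.
pose h (j : fold_pos (fun i => rev (bits (a i)))) : I * nat * bool :=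
  (fp_idx j, of_bits (fp_pre j), fp_elt j).
apply: ptime_trans _ (ptime_reindex h hs).
apply: ptime_node; last exact: ptime_snd (ptime_snd id).
by apply: ptime_node (ptime_fst id) (ptime_fst (ptime_snd id)).
Qed.

Lemma ptime_bitrec2 (a b : I -> nat) (e : nat -> nat -> tree) (c k : nat) :
  ptime X (fun i => enc_nat (a i)) -> ptime X (fun i => enc_nat (b i)) ->
  (forall m n, tree_size (e m n) <= c * (tree_size (enc_nat m) + tree_size (enc_nat
    n)) ^ k) ->
  ptime (fun j : nat * nat * (bool * bool) =>
           Node (e j.1.1 j.1.2) (Node (enc_bool j.2.1) (enc_bool j.2.2)))
        (fun j => e (j.2.1 + j.1.1.*2) (j.2.2 + j.1.2.*2)) ->
  ptime X (fun i => e (a i) (b i)).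
Proof.
move=> ha hb sb hs.
(* The two numbers need a common length; the sum of their lengths is at hand as the length of the
   concatenated digit lists. *)
pose K i := size (bits (a i)) + size (bits (b i)).
pose L i := rev [seq (odd (a i %/ 2 ^ k), odd (b i %/ 2 ^ k)) | k <- iota 0 (K i)].
pose st (s : nat * nat) (x : bool * bool) := (x.1 + s.1.*2, x.2 + s.2.*2).
have foldE l : foldl st (0, 0) l = (of_bits (map fst l), of_bits (map snd l)).
  elim/last_ind: l => // l x IH.
  by rewrite !map_rcons /of_bits !foldl_rcons IH.
have aE i : of_bits (map fst (L i)) = a i.
  rewrite /L map_rev -map_comp (of_bits_iota (n := a i)) ?divn1 //.
  by rewrite -size_bits_le leq_addr.
have bE i : of_bits (map snd (L i)) = b i.
  rewrite /L map_rev -map_comp (of_bits_iota (n := b i)) ?divn1 //.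
  by rewrite -size_bits_le leq_addl.
suff: ptime X (fun i => (fun s => e s.1 s.2) (foldl st (0, 0) (L i))).
  by move/eq_ptime; apply=> i; rewrite foldE aE bE.
pose eT (x : bool * bool) := Node (enc_bool x.1) (enc_bool x.2).
pose B i := c * (4 * tree_size (enc_nat (a i)) + 1 + (4 * tree_size (enc_nat (b i))
  + 1)) ^ k.
apply: (ptime_foldl (S := fun=> (nat * nat)%type) (eS := fun=> fun s => e s.1 s.2)
  (s0 := fun=> (0, 0)) (eT := fun=> eT) (L := L) (step := fun=> st) (b := B)).
- rewrite /L; apply: (eq_ptime (Y := fun i => enc_seq (rev (map (fun k =>
    eT (odd (a i %/ 2 ^ k), odd (b i %/ 2 ^ k))) (iota 0 (K i)))))); last first.
    by move=> i /=; rewrite map_rev -map_comp.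
  apply: ptime_rev; apply: (ptime_map (T := fun=> nat) (eT := fun=> enc_unary)
    (f := fun i k => eT (odd (a i %/ 2 ^ k), odd (b i %/ 2 ^ k)))).
    apply: eq_ptime (ptime_unary_iota (ptime_cat ha hb)) _ => i.
    by rewrite size_cat !(size_map enc_bool).
  (* Beyond the last digit, the default [Leaf] is the code of the digit 0. *)
  have bitE (n m : nat) : nth Leaf (map enc_bool (bits n)) m = enc_bool (odd (n %/
    2 ^ m)).
    rewrite -nth_bits; have [lt|ge] := ltnP m (size (bits n)); first exact: nth_map.
    by rewrite !nth_default ?(size_map enc_bool).
  have idj := ptime_tagged X (fun=> enc_unary).
  apply: ptime_node.
    apply: eq_ptime (ptime_nth idj (ptime_weak (fun=> enc_unary) ha)) _ => j.
    exact: bitE.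
  apply: eq_ptime (ptime_nth idj (ptime_weak (fun=> enc_unary) hb)) _ => j.
  exact: bitE.
- exact: eq_ptime (ptime_const X (e 0 0)) _.
- by have := ptime_size ha; have := ptime_size hb; rewrite /B => ? ?; pbound_tac.
- move=> i l1 l2 E; rewrite foldE; apply: leq_trans (sb _ _) _.
  rewrite leq_mul2l; apply/orP; right.
  case: (k) => // k'; rewrite leq_exp2r // leq_add //; apply: enc_nat_size_mono.
    by rewrite -aE E map_cat of_bits_cat_le.
  by rewrite -bE E map_cat of_bits_cat_le.
set C := fun j : fold_pos _ => _; have id := ptime_id C.
pose h (j : fold_pos L) : nat * nat * (bool * bool) :=
  (foldl st (0, 0) (fp_pre j), fp_elt j).
apply: ptime_trans _ (ptime_reindex h hs).
exact: ptime_snd id.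
Qed.

End BinaryRecursion.

Section Arithmetic.
Variables (I : Type) (X : I -> tree).

Lemma ptime_nat_if (c : I -> bool) (a b : I -> nat) :
  ptime X (fun i => enc_bool (c i)) ->
  ptime X (fun i => enc_nat (a i)) -> ptime X (fun i => enc_nat (b i)) ->
  ptime X (fun i => enc_nat (if c i then a i else b i)).
Proof.
by move=> hc ha hb; apply: eq_ptime (ptime_if_bool hc ha hb) _ => i; case: (c i).
Qed.

End Arithmetic.

Lemma ptime_bool_if I (X : I -> tree) (c a b : I -> bool) :
  ptime X (fun i => enc_bool (c i)) ->
  ptime X (fun i => enc_bool (a i)) -> ptime X (fun i => enc_bool (b i)) ->
  ptime X (fun i => enc_bool (if c i then a i else b i)).
Proof.
by move=> hc ha hb; apply: eq_ptime (ptime_if_bool hc ha hb) _ => i; case: (c i).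
Qed.

(* Both [m + n] and [m + n + 1] are maintained: the recursion runs from the most
   significant digit down, before the carry into it is known. *)
Lemma ptime_add I (X : I -> tree) (a b : I -> nat) :
  ptime X (fun i => enc_nat (a i)) -> ptime X (fun i => enc_nat (b i)) ->
  ptime X (fun i => enc_nat (a i + b i)).
Proof.
move=> ha hb.
pose e m n := Node (enc_nat (m + n)) (enc_nat (m + n + 1)).
apply: (ptime_fst (Z := fun i => enc_nat (a i + b i + 1))).
apply: (ptime_bitrec2 (e := e) (c := 100) (k := 1) ha hb) => [m n|].
  rewrite /e /= expn1; have := enc_nat_size_add m n.
  have := enc_nat_size_add m (n + 1); rewrite addnA.
  have := enc_nat_size_add n 1; rewrite [tree_size (enc_nat 1)]/=.
  by have := tree_size_gt0 (enc_nat m); lia.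
set C := fun j : nat * nat * (bool * bool) => _; have id := ptime_id C.
have h0 : ptime C (fun j => enc_nat (j.1.1 + j.1.2)) := ptime_fst (ptime_fst id).
have h1 : ptime C (fun j => enc_nat (j.1.1 + j.1.2 + 1)) := ptime_snd (ptime_fst id).
have hx : ptime C (fun j => enc_bool j.2.1) := ptime_fst (ptime_snd id).
have hy : ptime C (fun j => enc_bool j.2.2) := ptime_snd (ptime_snd id).
have r0 := ptime_double (ptime_addb hx hy) (ptime_nat_if (ptime_and hx hy) h1 h0).
have r1 := ptime_double (ptime_neg (ptime_addb hx hy)) (ptime_nat_if (ptime_or hx
  hy) h1 h0).
apply: eq_ptime (ptime_node r0 r1) _ => -[[m n] [x y]].
by rewrite /e; congr (Node (enc_nat _) (enc_nat _)); case: x; case: y => /=; lia.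
Qed.

(** As in addition, the differences with and without a borrow are both maintained. Since subtraction
    truncates, the two comparisons are needed to tell a genuine 0 from a truncated one before
    doubling. *)
Lemma ptime_sub_lt I (X : I -> tree) (a b : I -> nat) :
  ptime X (fun i => enc_nat (a i)) -> ptime X (fun i => enc_nat (b i)) ->
  ptime X (fun i => enc_nat (a i - b i)) /\ ptime X (fun i => enc_bool (a i < b i)).
Proof.
move=> ha hb.
pose e m n := Node (Node (enc_nat (m - n)) (enc_nat (m - (n + 1))))
                   (Node (enc_bool (m < n)) (enc_bool (m <= n))).
suff H : ptime X (fun i => e (a i) (b i)).
  by split; [exact: ptime_fst (ptime_fst H) | exact: ptime_fst (ptime_snd H)].
apply: (ptime_bitrec2 (e := e) (c := 100) (k := 1) ha hb) => [m n|].
  rewrite /e /= expn1; have := enc_nat_size_mono (leq_subr n m).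
  have := enc_nat_size_mono (leq_subr (n + 1) m).
  have sb (x : bool) : tree_size (enc_bool x) <= 3 by case: x.
  have := (sb (m < n), sb (m <= n)) => -[/= ? ?].
  by have := tree_size_gt0 (enc_nat m); lia.
set C := fun j : nat * nat * (bool * bool) => _; have id := ptime_id C.
have h0 : ptime C (fun j => enc_nat (j.1.1 - j.1.2)) := ptime_fst (ptime_fst
  (ptime_fst id)).
have h1 : ptime C (fun j => enc_nat (j.1.1 - (j.1.2 + 1))) := ptime_snd (ptime_fst
  (ptime_fst id)).
have l0 : ptime C (fun j => enc_bool (j.1.1 < j.1.2)) := ptime_fst (ptime_snd
  (ptime_fst id)).
have l1 : ptime C (fun j => enc_bool (j.1.1 <= j.1.2)) := ptime_snd (ptime_snd
  (ptime_fst id)).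
have hx : ptime C (fun j => enc_bool j.2.1) := ptime_fst (ptime_snd id).
have hy : ptime C (fun j => enc_bool j.2.2) := ptime_snd (ptime_snd id).
have h00 : ptime C (fun=> enc_nat 0) by rewrite enc_nat0; apply: ptime_leaf.
have b0 := ptime_and (ptime_neg hx) hy.
have b1 := ptime_or (ptime_neg hx) hy.
have f0 := ptime_bool_if b0 l1 l0.
have f1 := ptime_bool_if b1 l1 l0.
have r0 := ptime_nat_if f0 h00 (ptime_double (ptime_addb hx hy) (ptime_nat_if b0 h1
  h0)).
have r1 := ptime_nat_if f1 h00 (ptime_double (ptime_neg (ptime_addb hx hy))
  (ptime_nat_if b1 h1 h0)).
apply: eq_ptime (ptime_node (ptime_node r0 r1) (ptime_node f0 f1)) _ => -[[m n] [x
  y]].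
rewrite /e /=; congr (Node (Node (enc_nat _) (enc_nat _)) (Node (enc_bool _)
  (enc_bool _))).
all: by case: x; case: y => /=; case: ltngtP => //=; lia.
Qed.

Section Arithmetic2.
Variables (I : Type) (X : I -> tree) (a b : I -> nat).
Hypotheses (ha : ptime X (fun i => enc_nat (a i))) (hb : ptime X (fun i => enc_nat
  (b i))).

Lemma ptime_sub : ptime X (fun i => enc_nat (a i - b i)).
Proof. exact: (proj1 (ptime_sub_lt ha hb)). Qed.

Lemma ptime_leq : ptime X (fun i => enc_bool (a i <= b i)).
Proof.
apply: eq_ptime (ptime_neg (proj2 (ptime_sub_lt hb ha))) _ => i.
by rewrite -leqNgt.
Qed.

Lemma ptime_mul : ptime X (fun i => enc_nat (a i * b i)).
Proof.
pose B i := 16 * (tree_size (enc_nat (a i)) + tree_size (enc_nat (b i))) + 5.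
apply: (ptime_bitrec (e := fun i n => enc_nat (n * b i)) (b := B) ha).
- exact: eq_ptime (ptime_const X (enc_nat 0)) _.
- by have := ptime_size ha; have := ptime_size hb; rewrite /B => ? ?; pbound_tac.
- move=> i n le; rewrite /B.
  have : n * b i <= a i * b i by rewrite leq_mul2r le orbT.
  by move/enc_nat_size_mono; have := enc_nat_size_mul (a i) (b i); lia.
set C := fun j : I * nat * bool => _; have id := ptime_id C.
have hr : ptime C (fun j => enc_nat (j.1.2 * b j.1.1)) := ptime_snd (ptime_fst id).
have hx : ptime C (fun j => enc_bool j.2) := ptime_snd id.
have hbC : ptime C (fun j => enc_nat (b j.1.1)).
  exact: ptime_trans (ptime_fst (ptime_fst id)) (ptime_reindex (fun j : I * nat *
    bool => j.1.1) hb).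
have h0 : ptime C (fun=> enc_nat 0) by rewrite enc_nat0; apply: ptime_leaf.
apply: eq_ptime (ptime_add (ptime_double (ptime_const C (enc_bool false)) hr)
  (ptime_nat_if hx hbC h0)) _ => -[[i n] x] /=.
by congr enc_nat; case: x => /=; lia.
Qed.

End Arithmetic2.

Section Division.
Variables (I : Type) (X : I -> tree) (a b : I -> nat).
Hypotheses (ha : ptime X (fun i => enc_nat (a i))) (hb : ptime X (fun i => enc_nat
  (b i))).

Lemma ptime_edivn :
  ptime X (fun i => Node (enc_nat (a i %/ b i)) (enc_nat (a i %% b i))).
Proof.
pose B i := 8 * tree_size (enc_nat (a i)) + 3.
apply: (ptime_bitrec (e := fun i n => Node (enc_nat (n %/ b i)) (enc_nat (n %% b
  i))) (b := B) ha).
- apply: eq_ptime (ptime_const X (Node (enc_nat 0) (enc_nat 0))) _ => i.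
  by rewrite div0n mod0n.
- by have := ptime_size ha; rewrite /B => ?; pbound_tac.
- move=> i n le; rewrite /B /=.
  have /enc_nat_size_mono := leq_trans (leq_div n (b i)) le.
  by have /enc_nat_size_mono := leq_trans (leq_mod n (b i)) le; lia.
set C := fun j : I * nat * bool => _; have id := ptime_id C.
have hq : ptime C (fun j => enc_nat (j.1.2 %/ b j.1.1)) := ptime_fst (ptime_snd
  (ptime_fst id)).
have hr : ptime C (fun j => enc_nat (j.1.2 %% b j.1.1)) := ptime_snd (ptime_snd
  (ptime_fst id)).
have hx : ptime C (fun j => enc_bool j.2) := ptime_snd id.
have hbC : ptime C (fun j => enc_nat (b j.1.1)).
  exact: ptime_trans (ptime_fst (ptime_fst id)) (ptime_reindex (fun j : I * nat *
    bool => j.1.1) hb).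
have hr' := ptime_double hx hr.
(* Long division; for divisor 0 nothing is ever subtracted, in agreement with [n %/ 0 = 0] and
   [n %% 0 = n]. *)
have hc := ptime_and (ptime_pos hbC) (ptime_leq hbC hr').
apply: eq_ptime (ptime_node (ptime_double hc hq) (ptime_nat_if hc (ptime_sub hr'
  hbC) hr')) _.
move=> [[i n] x] /=; set d := b i; set r := x + (n %% d).*2.
have [d0|d0] := posnP d; first by rewrite /r d0 !modn0 !divn0.
have rE : x + n.*2 = (n %/ d).*2 * d + r.
  by rewrite /r {1}(divn_eq n d); nia.
have r2 : r < 2 * d by rewrite /r; have := ltn_pmod n d0; have := leq_b1 x; lia.
rewrite rE !divnMDl // !modnMDl /=.
have [le|lt] := leqP d r; last by rewrite (divn_small lt) (modn_small lt) addn0.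
have rd : r - d < d by lia.
have r1 : r = 1 * d + (r - d) by lia.
have -> : r %/ d = 1 by rewrite r1 divnMDl // (divn_small rd).
have -> : r %% d = r - d by rewrite {1}r1 modnMDl (modn_small rd).
by rewrite addnC.
Qed.

Lemma ptime_divn : ptime X (fun i => enc_nat (a i %/ b i)).
Proof. exact: ptime_fst ptime_edivn. Qed.

Lemma ptime_modn : ptime X (fun i => enc_nat (a i %% b i)).
Proof. exact: ptime_snd ptime_edivn. Qed.

End Division.

(** * Euclid's algorithm with a fixed number of steps *)

Definition euclid_step (s : nat * nat) : nat * nat :=
  if 0 < s.2 then (s.2, s.1 %% s.2) else s.

(** For [0 < b <= a] one has [2 * (a %% b) < a], so each step more than halves the product of the
    two entries; once the second entry is 0, the step changes nothing. *)
Lemma euclid_iter m a b : b <= a -> a * b < 2 ^ m ->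
  iter m.+1 euclid_step (a, b) = (gcdn a b, 0).
Proof.
elim: m a b => [|m IH] a b ba lt.
  have -> : b = 0 by move: lt; rewrite expn0; nia.
  by rewrite /= /euclid_step /= gcdn0.
have [-> | b0] := posnP b.
  by rewrite gcdn0 iter_fix.
rewrite iterSr; have -> : euclid_step (a, b) = (b, a %% b) by rewrite /euclid_step
  /= b0.
rewrite IH; first by rewrite gcdnC gcdn_modl.
  by rewrite ltnW // ltn_mod.
have mod2 : 2 * (a %% b) < a.
  have := ltn_mod a b; rewrite b0 => lb.
  have q0 : 0 < a %/ b by rewrite divn_gt0.
  by rewrite {2}(divn_eq a b); nia.
by move: lt; rewrite expnS; nia.
Qed.

(** One additional step at the start puts the entries in decreasing order and leaves their product
    below [2 ^ (m + n)]. *)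
Lemma euclid_gcd m n a b : a < 2 ^ m -> b < 2 ^ n ->
  (iter (m + n).+2 euclid_step (a, b)).1 = gcdn a b.
Proof.
move=> am bn; have [-> | b0] := posnP b; first by rewrite iter_fix // gcdn0.
rewrite iterSr; have -> : euclid_step (a, b) = (b, a %% b) by rewrite /euclid_step
  /= b0.
rewrite euclid_iter; first by rewrite gcdnC gcdn_modl.
  by rewrite ltnW // ltn_mod.
by rewrite expnD; have := leq_mod a b; nia.
Qed.

Lemma ptime_gcd I (X : I -> tree) (a b : I -> nat) :
  ptime X (fun i => enc_nat (a i)) -> ptime X (fun i => enc_nat (b i)) ->
  ptime X (fun i => enc_nat (gcdn (a i) (b i))).
Proof.
move=> ha hb.
(* Only the length counts: it is the number of steps in [euclid_gcd], with two leaves for the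
   [.+2]. *)
pose L i := [:: Leaf, Leaf & map enc_bool (bits (a i)) ++ map enc_bool (bits (b i))].
have hL : ptime X (fun i => enc_seq (L i)).
  by apply: ptime_node (ptime_leaf _) (ptime_node (ptime_leaf _) (ptime_cat ha hb)).
have foldE (l : seq tree) s : foldl (fun s (_ : tree) => euclid_step s) s l = iter
  (size l) euclid_step s.
  by elim: l s => //= x l IH s; rewrite IH -iterSr.
pose e (_ : I) (s : nat * nat) := Node (enc_nat s.1) (enc_nat s.2).
suff: ptime X (fun i => e i (foldl (fun s _ => euclid_step s) (a i, b i) (L i))).
  move=> h; apply: eq_ptime (ptime_fst h) _ => i; rewrite foldE.
  have -> : size (L i) = (size (bits (a i)) + size (bits (b i))).+2.
    by rewrite /= size_cat !(size_map enc_bool).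
  by rewrite euclid_gcd -?size_bits_le.
pose B i := 4 * tree_size (enc_nat (a i + b i)) + 1.
apply: (ptime_foldl_inv (S := fun=> (nat * nat)%type) (eS := e) (eT := fun=> id)
  (L := L) (s0 := fun i => (a i, b i)) (step := fun i s _ => euclid_step s)
  (Inv := fun i s => s.1 <= a i + b i /\ s.2 <= a i + b i) (b := fun i => (B i + B
    i).+1)).
- by apply: eq_ptime hL _ => i; rewrite map_id.
- exact: ptime_node ha hb.
- by have := ptime_size (ptime_add ha hb); rewrite /B => ?; pbound_tac.
- by move=> i /=; lia.
- move=> i [m n] _ [/= lm ln]; rewrite /euclid_step /=; case: ifP => //= _.
  by split => //; apply: leq_trans (leq_mod _ _) lm.
- by move=> i [m n] [/enc_nat_size_mono lm /enc_nat_size_mono ln] /=; rewrite ltnS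
  leq_add.
set C := fun j => Node (Node _ _) _; have id := ptime_id C.
have hs := ptime_snd (ptime_fst id).
have h1 := ptime_fst hs; have h2 := ptime_snd hs.
apply: eq_ptime (ptime_node (ptime_nat_if (ptime_pos h2) h2 h1)
  (ptime_nat_if (ptime_pos h2) (ptime_modn h1 h2) h2)) _ => j.
by rewrite /e /euclid_step; case: ifP.
Qed.

(** * Leaves of clique cutset decompositions *)

Section LeafSearch.
Variables (V : finType) (e : rel V).
Implicit Types (A B H K S X Y : {set V}).

Definition small H :=
  ~~ [exists x, exists y, exists z,
    [&& x \in H, y \in H, z \in H,
        compl_graph e x y, compl_graph e y z & compl_graph e x z]].

Definition interior A H :=
  [set h | (h \in H) && ~~ [exists z, [&& z \in A, e h z & z \notin H]]].

(** For [x = y] in [A] this is the closed neighbourhood of [x], which serves leaves whose closed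
    neighbourhood is a clique. *)
Definition seed A x y :=
  [set z | (z \in A) && [|| z == x, z == y | e x z && e y z]].

(* The induced paths with three or four vertices that join nonadjacent
   members of [H]. *)
Definition grow A H :=
  [set v | (v \in H) || (v \in A) && [exists x, exists y, exists u,
    [&& x \in H, y \in H, u \in A, compl_graph e x y, e x v, e u y &
        (v == u) || [&& e v u, ~~ e x u & ~~ e v y]]]].

Definition hull A x y := iter #|V| (grow A) (seed A x y).

(** The local test of the algorithm: all neighbours of the interior lying in [A] but outside the
    interior belong to [H :\: interior A H]. *)
Definition eliminable A H := clique e (H :\: interior A H) && small H.

Definition nbr A X := [set z in A | (z \notin X) && [exists x in X, e x z]].

Definition leaf A X :=
  [&& X != set0, X \subset A, clique e (nbr A X) & small (X :|: nbr A X)].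

(** Until it becomes stationary, each iteration gains a vertex. *)
Lemma iter_inflationary_fix (f : {set V} -> {set V}) A :
  (forall B, B \subset f B) -> f (iter #|V| f A) = iter #|V| f A.
Proof.
move=> inf.
have claim n : f (iter n f A) = iter n f A \/ n <= #|iter n f A|.
  elim: n => [|n IH] /=; first by right.
  have [E|ne] := eqVneq (f (iter n f A)) (iter n f A); first by left; rewrite E.
  case: IH => [E|IH]; first by rewrite E eqxx in ne.
  right; apply: leq_ltn_trans IH _; apply: proper_card.
  by rewrite properEneq eq_sym ne inf.
have [//|le] := claim #|V|.
have T : iter #|V| f A = setT by apply/eqP; rewrite eqEcard subsetT cardsT.
by apply/eqP; rewrite T -subTset -{1}T -T inf.
Qed.

Hypotheses (e_sym : symmetric e) (e_irr : irreflexive e).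

Lemma smallP H : reflect (forall x y z, x \in H -> y \in H -> z \in H ->
    x != y -> y != z -> x != z -> [|| e x y, e y z | e x z]) (small H).
Proof.
apply: (iffP idP) => [sm x y z xH yH zH xy yz xz|sm].
  move: sm; apply: contraR; rewrite !negb_or => /and3P[exy eyz exz].
  apply/existsP; exists x; apply/existsP; exists y; apply/existsP; exists z.
  by rewrite /compl_graph /= xH yH zH xy yz xz exy eyz exz.
apply/negP => /existsP[x /existsP[y /existsP[z /and5P[xH yH zH /andP[xy exy]
  /andP[/andP[yz eyz] /andP[xz exz]]]]]].
by have := sm x y z xH yH zH xy yz xz; rewrite (negPf exy) (negPf eyz) (negPf exz).
Qed.

Lemma cliqueP A : reflect {in A &, forall x y, x != y -> e x y} (clique e A).
Proof.
apply: (iffP forall_inP) => [cA x y xA yA xy|cA x xA].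
  by have /forall_inP/(_ y yA)/implyP := cA x xA; apply.
by apply/forall_inP => y yA; apply/implyP; apply: cA.
Qed.

Lemma cliqueS A B : A \subset B -> clique e B -> clique e A.
Proof. by move=> /subsetP AB /cliqueP cB; apply/cliqueP => x y /AB xB /AB; apply:
  cB. Qed.

Lemma smallS A B : A \subset B -> small B -> small A.
Proof.
move=> /subsetP AB /smallP sB; apply/smallP => x y z /AB xB /AB yB /AB.
exact: sB.
Qed.

Lemma clique_small A : clique e A -> small A.
Proof.
by move=> /cliqueP cA; apply/smallP => x y z xA yA _ /cA ->.
Qed.

(** Of three vertices, two lie on the same side of the bipartition of the complement. *)
Lemma cobipartite_small A : cobipartite e A -> small A.
Proof.
move=> /existsP[B /andP[/forall_inP i1 /forall_inP i2]]; apply/smallP => x y z xA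
  yA zA xy yz xz.
have adj u v : u \in A -> v \in A -> u != v -> (u \in B) = (v \in B) -> e u v.
  move=> uA vA uv; case uB : (u \in B) => /esym vB.
    have /i1/forall_inP/(_ v) : u \in A :&: B by rewrite inE uA uB.
    by rewrite inE vA vB /compl_graph /= uv negbK; apply.
  have /i2/forall_inP/(_ v) : u \in A :\: B by rewrite inE uA uB.
  by rewrite inE vA vB /compl_graph /= uv negbK; apply.
case: (boolP (x \in B == (y \in B))) => [/eqP E|xyB]; first by rewrite adj.
case: (boolP (y \in B == (z \in B))) => [/eqP E|yzB]; first by rewrite (adj y z)
  ?orbT.
by rewrite (adj x z) ?orbT //; move: xyB yzB; do 3!case: (_ \in B).
Qed.

(** Two strengthenings make the induction work: passing to induced subgraphs, as the algorithm does,
    and avoiding a clique [K], which becomes the separator when a side is considered. *)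
Definition leafy A := forall A' K, A' \subset A -> clique e K -> ~~ (A' \subset K) ->
  exists2 X, leaf A' X & [disjoint X & K].

(** All of [A' :\: K] can be taken, since its neighbourhood lies in [K]. *)
Lemma leafy_small A : small A -> leafy A.
Proof.
move=> sA A' K A'A cK nsub; exists (A' :\: K).
  rewrite /leaf setD_eq0 nsub subsetDl /=; apply/andP; split.
    apply: cliqueS cK; apply/subsetP => z; rewrite !inE => /and3P[zA'].
    by rewrite zA' andbT negbK.
  apply: smallS sA; apply: subset_trans A'A; apply/subsetP => z.
  by rewrite !inE => /orP[/andP[]|/andP[]].
by rewrite -setI_eq0; apply/eqP/setP => z; rewrite !inE; case: (z \in K); rewrite
  ?andbF.
Qed.

(** The leaf is sought on the side that [K] does not enter beyond the separator. Avoiding [S], it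
    keeps its neighbourhood in the whole graph. If [A'] has nothing on that side beyond [S], it lies
    entirely in the other side. *)
Lemma leafy_split A S V1 V2 :
  clique_separation e A S V1 V2 -> leafy V1 -> leafy V2 -> leafy A.
Proof.
case/and5P=> cS /eqP AE /eqP SE _ /andP[_ /forall_inP sep] l1 l2 A' K A'A cK nsub.
have {}sep x y : x \in V1 :\: S -> y \in V2 :\: S -> ~~ e x y.
  by move=> /sep/forall_inP; apply.
(* A clique cannot meet both [V1 :\: S] and [V2 :\: S]. *)
wlog K1 : V1 V2 AE SE sep l1 l2 / K :&: A' \subset V1.
  move=> wl; have [K1|/subsetPn[x]] := boolP (K :&: A' \subset V1); first exact:
    (wl V1 V2).
  rewrite inE => /andP[xK xA'] nx1.
  apply: (wl V2 V1) => //; rewrite 1?setUC //; first by rewrite setIC.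
    by move=> y z yS zS; rewrite e_sym; apply: sep.
  apply/subsetP => y; rewrite inE => /andP[yK yA']; apply: contraT => ny2.
  have x2 : x \in V2.
    by have := subsetP A'A x xA'; rewrite AE inE (negPf nx1).
  have y1 : y \in V1.
    by have := subsetP A'A y yA'; rewrite AE inE (negPf ny2) orbF.
  have := sep y x; rewrite -SE !inE y1 x2 (negPf nx1) (negPf ny2) /= => /(_ isT
    isT)/negP[].
  by apply: (cliqueP _ cK) => //; apply: contraNneq ny2 => ->.
have [sub|nsub2] := boolP (A' :&: V2 \subset S).
  have A'1 : A' \subset V1.
    apply/subsetP => x xA'; have := subsetP A'A x xA'; rewrite AE inE => /orP[//|x2].
    have : x \in S by apply: (subsetP sub); rewrite inE xA' x2.
    by rewrite -SE inE => /andP[].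
  exact: l1.
have [X lX dX] := l2 (A' :&: V2) S (subsetIr _ _) cS nsub2.
have XA : X \subset A' :&: V2 by case/and4P: lX.
(* [X] lies in [V2 :\: S], so it has no neighbours in [V1 :\: S]. *)
have nE : nbr A' X = nbr (A' :&: V2) X.
  apply/setP => z; rewrite !inE; case zA' : (z \in A') => //=.
  case zX : (z \in X); rewrite ?andbF //=.
  case z2 : (z \in V2) => //=; apply/negbTE/negP => /existsP[x /andP[xX exz]].
  have := subsetP XA x xX; rewrite inE => /andP[xA' x2].
  have xS : x \notin S by have := disjointFr dX xX => ->.
  have z1 : z \in V1 by have := subsetP A'A z zA'; rewrite AE inE z2 orbF.
  have := sep z x; rewrite -{1}SE !inE z1 z2 x2 xS /= => /(_ isT isT).
  by rewrite e_sym exz.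
exists X.
  move: lX; rewrite /leaf nE => /and4P[-> _ -> ->]; rewrite !andbT /=.
  exact: subset_trans XA (subsetIl _ _).
rewrite disjoint_subset; apply/subsetP => x xX; rewrite inE; apply/negP => xK.
have := subsetP XA x xX; rewrite inE => /andP[xA' x2].
have x1 : x \in V1 by apply: (subsetP K1); rewrite inE xK.
by have := disjointFr dX xX; rewrite -SE inE x1 x2.
Qed.

Lemma leafy_decomposition A s : clique_cutset_decomposition e A s ->
  (forall B, B \in s -> small B) -> leafy A.
Proof.
elim=> {A s} [A _ sA|A S V1 V2 s1 s2 _ sep _ IH1 _ IH2 sB].
  by apply/leafy_small/sA; rewrite mem_head.
by apply: leafy_split sep _ _; [apply: IH1|apply: IH2] => B Bs; apply: sB;
  rewrite mem_cat Bs ?orbT.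
Qed.

Lemma grow_inflationary A H : H \subset grow A H.
Proof. by apply/subsetP => v vH; rewrite inE vH. Qed.

Lemma grow_path3 A H x y v : x \in H -> y \in H -> x != y -> ~~ e x y ->
  v \in A -> e x v -> e v y -> v \in grow A H.
Proof.
move=> xH yH xy exy vA xv vy; rewrite inE vA /=; apply/orP; right.
apply/existsP; exists x; apply/existsP; exists y; apply/existsP; exists v.
by rewrite /compl_graph /= xH yH vA xy exy xv vy eqxx.
Qed.

Lemma grow_path4 A H x y v u : x \in H -> y \in H -> x != y -> ~~ e x y ->
  v \in A -> u \in A -> e x v -> e v u -> e u y -> ~~ e x u -> ~~ e v y ->
  v \in grow A H.
Proof.
move=> xH yH xy exy vA uA xv vu uy xu vy; rewrite inE vA /=; apply/orP; right.
apply/existsP; exists x; apply/existsP; exists y; apply/existsP; exists u.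
by rewrite /compl_graph /= xH yH uA xy exy xv vu uy xu vy orbT.
Qed.

Lemma grow_hull A x y : grow A (hull A x y) = hull A x y.
Proof. exact: iter_inflationary_fix (grow_inflationary A). Qed.

Lemma seed_sub_hull A x y : seed A x y \subset hull A x y.
Proof.
rewrite /hull; elim: #|V| => //= n IH.
exact: subset_trans IH (grow_inflationary A _).
Qed.

Lemma hull_sub A B x y : seed A x y \subset B ->
  (forall H, H \subset B -> grow A H \subset B) -> hull A x y \subset B.
Proof. by move=> sB gB; rewrite /hull; elim: #|V| => //= n /gB. Qed.

(** * Closed sets inside the closed neighbourhood of a minimal leaf *)

Section Leaf.
Variables (A X : {set V}).
Hypothesis lX : leaf A X.
Let S := nbr A X.
Let B := X :|: S.

Lemma leaf_setU z : z \in B -> z \in X \/ z \in S.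
Proof. by move/setUP. Qed.

Lemma leaf_nbr x z : x \in X -> z \in A -> e x z -> z \in B.
Proof.
move=> xX zA exz; rewrite !inE zA /=; case: (z \in X) => //=.
by apply/existsP; exists x; rewrite xX.
Qed.

Lemma leaf_nonadj x y : x \in B -> y \in B -> x != y -> ~~ e x y ->
  (x \in X) || (y \in X).
Proof.
have /and4P[_ _ /cliqueP cS _] := lX.
rewrite !inE => /orP[-> //|xS] /orP[->|yS]; first by rewrite orbT.
move=> xy; have -> // : e x y by apply: cS; rewrite // inE.
Qed.

(** One end of the path is in [X], since [S] is a clique. A new vertex outside [B] would have to be
    adjacent only to the end [x] in [S] and to a vertex [u] in [S], but then [x] and [u] are
    adjacent and the path is not induced. *)
Lemma leaf_grow H : H \subset B -> grow A H \subset B.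
Proof.
move=> /subsetP HB; apply/subsetP => v; rewrite inE => /orP[/HB//|/andP[vA]].
case/existsP=> x /existsP[y /existsP[u]].
case/and5P=> xH yH uA /andP[xy exy] /and3P[xv uy vu].
have [xX|nxX] := boolP (x \in X); first exact: leaf_nbr xv.
have yX : y \in X.
  by have := leaf_nonadj (HB _ xH) (HB _ yH) xy exy; rewrite (negPf nxX).
have uB : u \in B by apply: leaf_nbr yX uA _; rewrite e_sym.
case/orP: vu => [/eqP-> //|/and3P[vu xu vy]].
have := uB; rewrite inE => /orP[uX|uS]; first by apply: leaf_nbr uX vA _; rewrite
  e_sym.
have := HB _ xH; rewrite inE (negPf nxX) /= => xS.
have /and4P[_ _ /cliqueP cS _] := lX.
have xu' : x != u by apply: contraNneq exy => ->.
by have := cS x u xS uS xu'; rewrite (negPf xu).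
Qed.

Hypothesis minX : forall X', leaf A X' -> #|X| <= #|X'|.

(** A nonempty [C] would itself be a leaf; by minimality it would equal [X], although [X] meets [H]
    and [C] does not. What must be shown is that the neighbours of [C], all in [H], form a
    clique. *)
Lemma leaf_no_component H (C : {set V}) : grow A H = H -> H \subset B -> ~~
  [disjoint X & H] ->
  C \subset X :\: H ->
  (forall c z, c \in C -> z \in A -> e c z -> z \in C :|: H) -> C = set0.
Proof.
have /and4P[_ XA _ /smallP sB] := lX.
move=> gH /subsetP HB XH.
have [n] := ubnP #|C|; elim: n C => // n IH C; rewrite ltnS => Cn CXH clC.
have CX : C \subset X by apply: subset_trans CXH (subsetDl _ _).
have CnH c : c \in C -> c \notin H by move/(subsetP CXH); rewrite inE => /andP[].
apply/eqP; apply: contraNT XH => C0.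
suff lC : leaf A C.
  have /(_ CX)/eqP CE : C \subset X -> C == X by move=> ?; rewrite eqEcard minX
    ?andbT.
  by rewrite -CE disjoint_subset; apply/subsetP => c /CnH; rewrite inE.
have nC z : z \in nbr A C -> exists2 c, c \in C & e c z /\ z \in H.
  rewrite !inE => /and3P[zA zC /existsP[c /andP[cC ecz]]].
  by have := clC c z cC zA ecz; rewrite inE (negPf zC) /= => zH; exists c.
rewrite /leaf C0 (subset_trans CX XA) /=; apply/andP; split; last first.
  apply/smallP => x y z xB yB zB; apply: sB.
  - move: xB; rewrite inE => /orP[/(subsetP CX)|/nC[c _ [_ /HB]]//].
    by rewrite !inE => ->.
  - move: yB; rewrite inE => /orP[/(subsetP CX)|/nC[c _ [_ /HB]]//].
    by rewrite !inE => ->.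
  move: zB; rewrite inE => /orP[/(subsetP CX)|/nC[c _ [_ /HB]]//].
  by rewrite !inE => ->.
apply/cliqueP => p q /nC[c cC [cp pH]] /nC[d dC [dq qH]] pq; apply/negPn/negP => epq.
have AC c' : c' \in C -> c' \in A by move/(subsetP CX)/(subsetP XA).
have BC c' : c' \in C -> c' \in B by move/(subsetP CX); rewrite inE => ->.
have notboth c' : c' \in C -> e p c' -> ~~ e c' q.
  move=> cC' pc; apply/negP => cq; have /negP[] := CnH _ cC'.
  by rewrite -gH; apply: grow_path3 pH qH pq epq (AC _ cC') pc cq.
have neH c' h : c' \in C -> h \in H -> h != c'.
  by move=> /CnH nH hH; apply: contraNneq nH => <-.
(* For nonadjacent neighbours [p] and [q], the vertices of [C] adjacent to [p] form a proper subset,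
   as no vertex of [C] sees both. This subset again has all its neighbours in itself or [H], so by
   induction it is empty. *)
have := IH [set c' in C | e p c'].
suff Cp0 : [set c' in C | e p c'] = set0 -> False.
  move=> H'; apply: Cp0; apply: H'.
  - apply: leq_trans Cn; apply: proper_card; apply/properP; split.
      by apply/subsetP => z; rewrite inE => /andP[].
    exists d => //; rewrite inE dC /=; apply/negP => pd.
    by have := notboth d dC pd; rewrite dq.
  - by apply: subset_trans CXH; apply/subsetP => z; rewrite inE => /andP[].
  move=> c' z; rewrite !inE => /andP[cC' pc'] zA cz.
  have := clC c' z cC' zA cz; rewrite inE => /orP[zC|->]; last by rewrite orbT.
  rewrite zC /=; apply/orP; left; apply/negPn/negP => pz.
  (* As [p], [q], [z] are not independent, [z] is adjacent to [q], and the induced path [p], [c'],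
     [z], [q] would put [c'] into [H]. *)
  have := sB p q z (HB _ pH) (HB _ qH) (BC _ zC) pq (neH _ _ zC qH) (neH _ _ zC pH).
  rewrite (negPf epq) (negPf pz) orbF /= => qz.
  have /negP[] := CnH _ cC'; rewrite -gH.
  apply: (grow_path4 (x := p) (y := q) (u := z)) => //; rewrite ?AC //.
    by rewrite e_sym.
  exact: notboth.
by move/setP/(_ c); rewrite !inE cC e_sym cp.
Qed.

(** Suppose boundary vertices [p] and [q] are nonadjacent. Smallness of [B] and closure of [H] split
    [B :\: H] into the neighbours of [p] and those of [q], with no edge between the classes. Both
    classes turn out to be excluded by [leaf_no_component], which contradicts the neighbour of [p]
    outside [H]. *)
Lemma leaf_boundary H : grow A H = H -> H \subset B -> ~~ [disjoint X & H] ->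
  clique e (H :\: interior A H).
Proof.
have /and4P[_ XA /cliqueP cS /smallP sB] := lX.
move=> gH HB XH; have noC := leaf_no_component gH HB XH.
apply/cliqueP => p q; rewrite !inE => /andP[np pH] /andP[nq qH] pq.
move: np nq; rewrite pH qH /= !negbK.
case/existsP=> p' /and3P[p'A pp' p'H] /existsP[q' /and3P[q'A qq' q'H]].
apply/negPn/negP => epq.
(* At most one of [p], [q] has neighbours in [S :\: H]: as [S] is a clique, neighbours [t] of [p]
   and [s] of [q] would either coincide or give the path [p], [t], [s], [q], and [H] would contain
   [t]. *)
wlog SBq : p q p' q' pH qH pq epq p'A pp' p'H q'A qq' q'H /
    (forall s, s \in S -> s \notin H -> ~~ e q s).
  move=> wl; have [/forallP Sq|/forallPn[s]] :=
    boolP [forall s, (s \in S) ==> (s \notin H) ==> ~~ e q s].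
    by apply: (wl p q p' q') => // s sS sH; move: (Sq s); rewrite sS sH.
  rewrite !negb_imply => /and4P[sS sH qs _].
  apply: (wl q p q' p') => //; rewrite 1?eq_sym // 1?e_sym // => t tS tH.
  apply/negP => pt.
  have BS r : r \in S -> r \in A by rewrite inE => /andP[].
  have [E|ts] := eqVneq t s.
    by move/negP: (sH); apply; rewrite -gH;
       apply: grow_path3 pH qH pq epq (BS _ sS) _ _; rewrite -?E // E e_sym.
  have ets := cS t s tS sS ts.
  have nb r : r \in S -> r \notin H -> e p r -> ~~ e r q.
    move=> rS rH pr; apply: contraNN rH => rq; rewrite -gH.
    exact: grow_path3 pH qH pq epq (BS _ rS) pr rq.
  move/negP: (tH); apply; rewrite -gH.
  apply: (grow_path4 (x := p) (y := q) (u := s)); rewrite ?BS //.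
  - by rewrite e_sym.
  - by apply: contraL qs => ps; rewrite e_sym nb.
  exact: nb.
have BA r : r \in B -> r \in A by rewrite !inE => /orP[/(subsetP XA)|/andP[]].
have HinB h : h \in H -> h \in B by apply: (subsetP HB).
have neH b h : b \notin H -> h \in H -> h != b by move=> nb hH; apply: contraNneq
  nb => <-.
have cover b : b \in B -> b \notin H -> e p b || e q b.
  move=> bB bH; have := sB p q b (HinB _ pH) (HinB _ qH) bB pq (neH _ _ bH qH) (neH
    _ _ bH pH).
  by rewrite (negPf epq) /= orbC.
have excl b : b \in B -> b \notin H -> e p b -> ~~ e b q.
  move=> bB bH pb; apply: contraNN bH => bq; rewrite -gH.
  exact: grow_path3 pH qH pq epq (BA _ bB) pb bq.
have noedge b c : b \in B -> b \notin H -> c \in B -> c \notin H ->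
    e p b -> e q c -> ~~ e b c.
  move=> bB bH cB cH pb qc; apply: contraNN (bH) => bc; rewrite -gH.
  apply: (grow_path4 (x := p) (y := q) (u := c)); rewrite ?BA //.
  - by rewrite e_sym.
  - by apply: contraL qc => pc; rewrite e_sym excl.
  exact: excl.
(* By the choice of [q], this class lies in [X]. *)
have Bq0 : [set b in B :\: H | e q b] = set0.
  apply: noC.
    apply/subsetP => b; rewrite [b \in _]inE => /andP[]; rewrite in_setD =>
      /andP[bH bB] qb.
    rewrite in_setD bH; case: (leaf_setU bB) => [//|bS].
    by have := SBq b bS bH; rewrite qb.
  move=> c z; rewrite [c \in _]inE => /andP[]; rewrite in_setD => /andP[cH cB] qc
    zA cz.
  have cX : c \in X.
    case: (leaf_setU cB) => [//|cS'].
    by have := SBq c cS' cH; rewrite qc.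
  have zB := leaf_nbr cX zA cz.
  rewrite in_setU; have [zH|zH] := boolP (z \in H); first by rewrite orbT.
  rewrite orbF [z \in _]inE in_setD zB zH /=; have := cover z zB zH => /orP[pz|//].
  by have := noedge z c zB zH cB cH pz qc; rewrite e_sym cz.
have nBq b : b \in B -> b \notin H -> ~~ e q b.
  move=> bB bH; apply/negP => qb; have := in_set0 b.
  by rewrite -Bq0 inE in_setD bH bB qb.
(* If [q] were in [X], its neighbour [q'] would be in [B], hence in the class just shown to be
   empty. *)
have qS : q \in S.
  case: (leaf_setU (HinB _ qH)) => [qX|//].
  by have := nBq q' (leaf_nbr qX q'A qq') q'H; rewrite qq'.
have pX : p \in X.
  have := leaf_nonadj (HinB _ pH) (HinB _ qH) pq epq => /orP[//|qX].
  by move: qS; rewrite inE qX andbF.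
(* A vertex of [S :\: H] would be adjacent to [q] in the clique [S]; thus [B :\: H] lies in [X], and
   the lemma applies to the other class too. *)
have Bp0 : [set b in B :\: H | e p b] = set0.
  have XnH b : b \in B -> b \notin H -> b \in X.
    move=> bB bH; case: (leaf_setU bB) => [//|bS].
    by have := cS q b qS bS (neH _ _ bH qH); rewrite (negPf (nBq b bB bH)).
  apply: noC.
    apply/subsetP => b; rewrite [b \in _]inE => /andP[]; rewrite in_setD =>
      /andP[bH bB] _.
    by rewrite in_setD bH XnH.
  move=> c z; rewrite [c \in _]inE => /andP[]; rewrite in_setD => /andP[cH cB] pc
    zA cz.
  have zB := leaf_nbr (XnH c cB cH) zA cz.
  rewrite in_setU; have [zH|zH] := boolP (z \in H); first by rewrite orbT.
  rewrite orbF [z \in _]inE in_setD zB zH /=; by have := cover z zB zH; rewrite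
    (negPf (nBq z zB zH)) orbF.
have p'B := leaf_nbr pX p'A pp'.
by have := in_set0 p'; rewrite -Bp0 inE in_setD p'H p'B pp'.
Qed.

End Leaf.

Lemma exists_eliminable A : leafy setT -> A != set0 ->
  exists x y, eliminable A (hull A x y) && (interior A (hull A x y) != set0).
Proof.
move=> lV A0.
have [||X0 lX0 _] := lV A set0 (subsetT _); first by apply/cliqueP => x y; rewrite
  inE.
  by rewrite subset0.
case: (arg_minnP (fun X : {set V} => #|X|) lX0) => X lX minX.
have /and4P[X0' XA cS sB] := lX; pose B := X :|: nbr A X.
(* There may be no nonadjacent pair to start from; then the pair [x], [x] with [x] in [X] works, and
   [x] itself is interior. *)
have [cB|] := boolP (clique e B).
  have [x xX] := set0Pn _ X0'; exists x, x.
  have HB : hull A x x \subset B.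
    apply: hull_sub (leaf_grow lX); apply/subsetP => z; rewrite inE => /andP[zA].
    case/or3P=> [/eqP->|/eqP->|/andP[xz _]]; rewrite ?inE ?xX //.
    by have := leaf_nbr xX zA xz; rewrite !inE.
  rewrite /eliminable (cliqueS _ cB) ?(smallS HB) //=; last first.
    exact: subset_trans (subsetDl _ _) HB.
  apply/set0Pn; exists x; rewrite inE.
  have sH z : z \in seed A x x -> z \in hull A x x := subsetP (seed_sub_hull A x x) z.
  rewrite sH /=; last by rewrite inE (subsetP XA) // eqxx.
  by apply/existsP => -[z /and3P[zA xz /negP[]]]; apply: sH; rewrite inE zA xz !orbT.
move=> ncB; have [x [y [xB yB xy exy]]] :
    exists x y, [/\ x \in B, y \in B, x != y & ~~ e x y].
  move: ncB; rewrite /clique => /forall_inPn[x xB /forall_inPn[y yB]].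
  by rewrite negb_imply => /andP[xy exy]; exists x, y.
exists x, y.
have HB : hull A x y \subset B.
  apply: hull_sub (leaf_grow lX); apply/subsetP => z; rewrite inE => /andP[zA].
  case/or3P=> [/eqP->|/eqP->|/andP[xz yz]] //.
  by case/orP: (leaf_nonadj lX xB yB xy exy) => /leaf_nbr; apply.
have BA r : r \in B -> r \in A by rewrite !inE => /orP[/(subsetP XA)|/andP[]].
have sH z : z \in seed A x y -> z \in hull A x y := subsetP (seed_sub_hull A x y) z.
have xH : x \in hull A x y by rewrite sH // inE BA // eqxx.
have yH : y \in hull A x y by rewrite sH // inE BA // eqxx orbT.
have cH : clique e (hull A x y :\: interior A (hull A x y)).
  apply: (leaf_boundary lX) => //; first exact: grow_hull.
  apply/negP => dis; case/orP: (leaf_nonadj lX xB yB xy exy) => zX.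
    by rewrite (disjointFr dis zX) in xH.
  by rewrite (disjointFr dis zX) in yH.
rewrite /eliminable cH (smallS HB) //=.
(* With an empty interior the whole hull would be a clique, but it contains [x] and [y]. *)
apply/negP => /eqP I0; move: cH; rewrite I0 setD0 => /cliqueP/(_ x y xH yH xy).
by rewrite (negPf exy).
Qed.

End LeafSearch.

Import Order.TTheory GRing.Theory Num.Theory.
Local Open Scope ring_scope.

(** * Rational arithmetic *)

Definition numn (x : rat) : nat := `|numq x|%N.
Definition denn (x : rat) : nat := `|denq x|%N.
(** The sum rather than the maximum: heights are then submultiplicative under addition, and their
    product expands into a sum over all vertex sets. *)
Definition height (x : rat) : nat := (numn x + denn x)%N.

Lemma denn_gt0 x : (0 < denn x)%N.
Proof. by rewrite absz_gt0 denq_neq0. Qed.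

Lemma nnrat_frac x : 0 <= x -> x = (numn x)%:R / (denn x)%:R.
Proof.
move=> x0; rewrite -{1}[x]divq_num_den /numn /denn.
by rewrite !pmulrn !gez0_abs ?denq_ge0 ?numq_ge0.
Qed.

Lemma num_den_frac (a b : nat) : (0 < b)%N ->
  numn (a%:R / b%:R) = (a %/ gcdn a b)%N /\ denn (a%:R / b%:R) = (b %/ gcdn a b)%N.
Proof.
move=> b0; have g0 : (0 < gcdn a b)%N by rewrite gcdn_gt0 b0 orbT.
set g := gcdn a b in g0 *.
have ga : (a %/ g * g)%N = a by rewrite divnK // dvdn_gcdl.
have gb : (b %/ g * g)%N = b by rewrite divnK // dvdn_gcdr.
have bg0 : (0 < b %/ g)%N by rewrite divn_gt0 // dvdn_leq // dvdn_gcdr.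
have cop : coprime `|(a %/ g)%N%:Z| `|(b %/ g)%N%:Z|.
  by rewrite /coprime !absz_nat -(eqn_pmul2r g0) muln_gcdl ga gb mul1n.
have -> : a%:R / b%:R = (a %/ g)%N%:Z%:~R / (b %/ g)%N%:Z%:~R :> rat.
  rewrite -{1}ga -{1}gb !natrM -!pmulrn invfM mulrACA divff ?mulr1 //.
  by rewrite pnatr_eq0 -lt0n.
rewrite /numn /denn coprimeq_num // coprimeq_den // gtr0_sg ?ltz_nat // mul1r.
by rewrite eqz_nat gtn_eqF //= absz_nat.
Qed.

Lemma height_frac (a b : nat) : (0 < b)%N -> (height (a%:R / b%:R) <= a + b)%N.
Proof.
by move=> b0; rewrite /height; case: (num_den_frac a b0) => -> ->; rewrite leq_add
  ?leq_div.
Qed.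

Lemma height_add x y : 0 <= x -> 0 <= y -> (height (x + y) <= height x * height y)%N.
Proof.
move=> /nnrat_frac {1}-> /nnrat_frac {1}->.
have [dx dy] := (denn_gt0 x, denn_gt0 y).
rewrite addf_div ?pnatr_eq0 -?lt0n // -!natrM -natrD.
by apply: leq_trans (height_frac _ _) _; rewrite ?muln_gt0 ?dx // /height; lia.
Qed.

Lemma height_le_size (x : rat) (M : nat) : (height x <= M)%N ->
  (tree_size (enc_rat x) <= 8 * tree_size (enc_nat M) + 3)%N.
Proof.
rewrite /height => hM; rewrite /enc_rat /= -/(numn x) -/(denn x).
have /enc_nat_size_mono := leq_trans (leq_addr _ _) hM.
by have /enc_nat_size_mono := leq_trans (leq_addl _ _) hM; lia.
Qed.

Lemma height_le_exp (x : rat) : (height x <= 2 ^ tree_size (enc_rat x))%N.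
Proof.
rewrite /height /enc_rat /= -/(numn x) -/(denn x) -addSn expnD expnS.
have := (enc_nat_size_lt (numn x), enc_nat_size_lt (denn x)) => -[/=].
by set a := (2 ^ _)%N; set b := (2 ^ _)%N; nia.
Qed.

(** [8 * (4 * (e + 1) + 1) + 3 = 32 * e + 43]. *)
Lemma enc_rat_size_le (x : rat) e : (height x <= 2 ^ e)%N ->
  (tree_size (enc_rat x) <= 32 * e + 43)%N.
Proof.
move=> /height_le_size; have : (2 ^ e < 2 ^ e.+1)%N by rewrite ltn_exp2l.
move=> /enc_nat_size_le; lia.
Qed.

Section Rationals.
Variables (I : Type) (X : I -> tree).
Implicit Types x y : I -> rat.

Lemma ptime_num x :
  ptime X (fun i => enc_rat (x i)) -> ptime X (fun i => enc_nat (numn (x i))).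
Proof. exact: ptime_fst. Qed.

Lemma ptime_den x :
  ptime X (fun i => enc_rat (x i)) -> ptime X (fun i => enc_nat (denn (x i))).
Proof. exact: ptime_snd. Qed.

Lemma ptime_frac (a b : I -> nat) : (forall i, (0 < b i)%N) ->
  ptime X (fun i => enc_nat (a i)) -> ptime X (fun i => enc_nat (b i)) ->
  ptime X (fun i => enc_rat ((a i)%:R / (b i)%:R)).
Proof.
move=> b0 ha hb; have hg := ptime_gcd ha hb.
apply: eq_ptime (ptime_node (ptime_divn ha hg) (ptime_divn hb hg)) _ => i.
by case: (num_den_frac (a i) (b0 i)) => <- <-.
Qed.

Lemma ptime_addq x y : (forall i, 0 <= x i) -> (forall i, 0 <= y i) ->
  ptime X (fun i => enc_rat (x i)) -> ptime X (fun i => enc_rat (y i)) ->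
  ptime X (fun i => enc_rat (x i + y i)).
Proof.
move=> x0 y0 hx hy.
have [[[nx dx] ny] dy] := (ptime_num hx, ptime_den hx, ptime_num hy, ptime_den hy).
have b0 i : (0 < denn (x i) * denn (y i))%N by rewrite muln_gt0 !denn_gt0.
apply: eq_ptime (ptime_frac b0 (ptime_add (ptime_mul nx dy) (ptime_mul ny dx))
  (ptime_mul dx dy)) _ => i; congr enc_rat.
rewrite natrD !natrM [in RHS](nnrat_frac (x0 i)) [in RHS](nnrat_frac (y0 i)).
by rewrite addf_div // pnatr_eq0 -lt0n denn_gt0.
Qed.

Lemma ptime_mulq x y : (forall i, 0 <= x i) -> (forall i, 0 <= y i) ->
  ptime X (fun i => enc_rat (x i)) -> ptime X (fun i => enc_rat (y i)) ->
  ptime X (fun i => enc_rat (x i * y i)).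
Proof.
move=> x0 y0 hx hy.
have [[[nx dx] ny] dy] := (ptime_num hx, ptime_den hx, ptime_num hy, ptime_den hy).
have b0 i : (0 < denn (x i) * denn (y i))%N by rewrite muln_gt0 !denn_gt0.
apply: eq_ptime (ptime_frac b0 (ptime_mul nx ny) (ptime_mul dx dy)) _ => i; congr
  enc_rat.
rewrite !natrM [in RHS](nnrat_frac (x0 i)) [in RHS](nnrat_frac (y0 i)).
by rewrite mulf_div.
Qed.

Lemma ptime_divq x y : (forall i, 0 <= x i) -> (forall i, 0 < y i) ->
  ptime X (fun i => enc_rat (x i)) -> ptime X (fun i => enc_rat (y i)) ->
  ptime X (fun i => enc_rat (x i / y i)).
Proof.
move=> x0 y0 hx hy.
have [[[nx dx] ny] dy] := (ptime_num hx, ptime_den hx, ptime_num hy, ptime_den hy).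
have b0 i : (0 < denn (x i) * numn (y i))%N.
  by rewrite muln_gt0 denn_gt0 absz_gt0 numq_eq0 gt_eqF.
apply: eq_ptime (ptime_frac b0 (ptime_mul nx dy) (ptime_mul dx ny)) _ => i; congr
  enc_rat.
rewrite !natrM [in RHS](nnrat_frac (x0 i)) [in RHS](nnrat_frac (ltW (y0 i))).
by rewrite invf_div mulf_div.
Qed.

Lemma ptime_rat_if (c : I -> bool) x y :
  ptime X (fun i => enc_bool (c i)) ->
  ptime X (fun i => enc_rat (x i)) -> ptime X (fun i => enc_rat (y i)) ->
  ptime X (fun i => enc_rat (if c i then x i else y i)).
Proof.
by move=> hc hx hy; apply: eq_ptime (ptime_if_bool hc hx hy) _ => i; case: (c i).
Qed.

End Rationals.

Lemma sumr_ge0_seq (s : seq rat) : all (>= 0) s -> 0 <= \sum_(x <- s) x.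
Proof. by move=> /allP s0; rewrite big_seq; apply: sumr_ge0 => x /s0. Qed.

(** A partial sum has height at most the product of the heights of its terms, so its length is
    linear in the size of the list. *)
Lemma ptime_sumq I (X : I -> tree) (l : I -> seq rat) :
  (forall i, all (>= 0) (l i)) ->
  ptime X (fun i => enc_seq (map enc_rat (l i))) ->
  ptime X (fun i => enc_rat (\sum_(x <- l i) x)).
Proof.
move=> l0 hl.
have sum_l (s : seq rat) : \sum_(x <- s) x = foldl +%R 0 s.
  elim/last_ind: s => [|s x IH]; first by rewrite big_nil.
  by rewrite foldl_rcons -IH -cats1 big_cat big_seq1.
suff: ptime X (fun i => enc_rat (foldl +%R 0 (l i))).
  by move/eq_ptime; apply=> i; rewrite sum_l.
pose B i := (32 * tree_size (enc_seq (map enc_rat (l i))) + 43)%N.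
apply: (ptime_foldl (S := fun=> rat) (T := fun=> rat) (eS := fun=> enc_rat)
  (eT := fun=> enc_rat) (L := l) (s0 := fun=> 0) (step := fun=> +%R) (b := B) hl).
- exact: (ptime_const X (enc_rat 0)).
- by have := ptime_size hl; rewrite /B => ?; pbound_tac.
- move=> i l1 l2 E; apply: enc_rat_size_le; have := l0 i; rewrite E all_cat =>
  /andP[p1 _].
  rewrite map_cat tree_size_enc_seq map_cat sumn_cat -!addnA.
  apply: leq_trans (_ : 2 ^ sumn [seq tree_size j | j <- map enc_rat l1] <= _)%N;
    last first.
    by rewrite leq_exp2l // -addnS leq_addr.
  elim/last_ind: l1 p1 {E} => [|s x IH]; first by rewrite /height /numn /denn.
  rewrite all_rcons => /andP[x0 s0]; rewrite foldl_rcons.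
  apply: leq_trans (height_add _ x0) _; first by rewrite -sum_l sumr_ge0_seq.
  rewrite !map_rcons sumn_rcons expnD leq_mul ?height_le_exp //.
  exact: IH.
set C := fun j : fold_pos _ => _; have id := ptime_id C.
apply: ptime_addq; last exact: ptime_snd (ptime_snd id).
- move=> j; have := l0 (fp_idx j); rewrite (fp_eq j) all_cat => /andP[p1 _].
  by rewrite -sum_l sumr_ge0_seq.
- by move=> j; have := l0 (fp_idx j); rewrite (fp_eq j) all_cat /= => /and3P[].
exact: ptime_fst (ptime_snd id).
Qed.

(** * Elimination of a leaf *)

Section Counting.
Variables (V : finType) (e : rel V).
Implicit Types (A B J S T X Y : {set V}) (u w : V -> rat).

Definition set_weight u A : rat :=
  \sum_(S : {set V} | (S \subset A) && independent e S) \prod_(v in S) u v.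

Definition nbhd J := [set z | [exists v in J, e v z]].

Definition elim_weight u A X (v : V) : rat :=
  if v \in A :\: X then u v * set_weight u (X :\: nbhd [set v]) / set_weight u X
    else 0.

(** Independent sets of a small set have at most two vertices. The factor 1/2 compensates for
    counting each nonadjacent pair in both orders; the formula is thus computable in polynomial
    time. *)
Definition small_weight u Y : rat :=
  1 + \sum_(x in Y) u x * (1 + 2^-1 * \sum_(y in Y | compl_graph e x y) u y).

Lemma independentP S : reflect {in S &, forall x y, ~~ e x y} (independent e S).
Proof.
apply: (iffP forall_inP) => [iS x y xS yS|iS x xS].
  by have /forall_inP/(_ y yS) := iS x xS.
by apply/forall_inP => y yS; apply: iS.
Qed.

Lemma independentS S T : S \subset T -> independent e T -> independent e S.
Proof.
move=> /subsetP ST /independentP iT; apply/independentP => x y /ST xT /ST.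
exact: iT.
Qed.

Lemma independent0 : independent e set0.
Proof. by apply/independentP => x y; rewrite inE. Qed.

Lemma set_weight_ge1 u A : (forall v, 0 <= u v) -> 1 <= set_weight u A.
Proof.
move=> u0; rewrite /set_weight (bigD1 set0) /=; last by rewrite sub0set independent0.
rewrite big_set0 lerDl; apply: sumr_ge0 => S _; exact: prodr_ge0.
Qed.

Lemma set_weight_gt0 u A : (forall v, 0 <= u v) -> 0 < set_weight u A.
Proof. by move=> /(set_weight_ge1 A); apply: lt_le_trans. Qed.

Lemma eq_set_weight u w A : {in A, u =1 w} -> set_weight u A = set_weight w A.
Proof.
move=> uw; apply: eq_bigr => S /andP[/subsetP SA _].
by apply: eq_bigr => v /SA; apply: uw.
Qed.

Lemma set_weight0 u : set_weight u set0 = 1.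
Proof.
rewrite /set_weight (bigD1 set0) /=; last by rewrite sub0set independent0.
by rewrite big_set0 big1 ?addr0 // => S; rewrite subset0 => /andP[/andP[->]].
Qed.

Lemma elim_weight_ge0 u A X v : (forall v, 0 <= u v) -> 0 <= elim_weight u A X v.
Proof.
move=> u0; rewrite /elim_weight; case: ifP => // _.
by rewrite divr_ge0 ?mulr_ge0 // ltW // set_weight_gt0.
Qed.

Hypotheses (e_sym : symmetric e) (e_irr : irreflexive e).

(** Independent sets are sorted by their trace [J] on [B]. *)
Lemma set_weight_split u B X : [disjoint B & X] ->
  set_weight u (B :|: X) = \sum_(J : {set V} | (J \subset B) && independent e J)
    (\prod_(v in J) u v) * set_weight u (X :\: nbhd J).
Proof.
move=> dBX.
rewrite /set_weight (partition_big (fun S : {set V} => S :&: B)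
  (fun J => (J \subset B) && independent e J)) /=; last first.
  by move=> S /andP[_ iS]; rewrite subsetIr (independentS (subsetIl _ _)).
apply: eq_bigr => J /andP[JB iJ].
rewrite big_distrr /= (reindex_onto (fun T => J :|: T) (fun S => S :&: X)) /=; last
  first.
  move=> S /andP[/andP[SBX _] /eqP <-]; rewrite -setIUr; exact/setIidPl.
have dJX : J :&: X = set0 by apply/disjoint_setI0/(disjointWl JB).
apply: eq_big => [T|T /andP[/andP[/andP[_ _] /eqP TB] /eqP TX]]; last first.
  rewrite -bigU //=; last first.
    by rewrite -setI_eq0 -subset0 -dJX -TX; apply/setIS/subsetIr.
  by apply: eq_bigl => v; rewrite !inE.
apply/idP/idP.
  case/andP=> /andP[/andP[sub iJT] /eqP TB] /eqP TX.
  rewrite (independentS (subsetUr _ _) iJT) andbT; apply/subsetP => t tT.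
  have tX : t \in X by move: tT; rewrite -TX inE => /andP[].
  rewrite inE tX andbT inE; apply/existsP => -[v /andP[vJ evt]].
  have /independentP/(_ v t) := iJT; rewrite !inE vJ tT orbT evt.
  by move/(_ isT isT).
case/andP=> /subsetP TX iT.
have TX' : T \subset X by apply/subsetP => t /TX; rewrite inE => /andP[].
rewrite setUSS //=; apply/andP; split; last first.
  by rewrite setIUl dJX set0U; apply/eqP/setIidPl.
apply/andP; split; last first.
  rewrite setIUl (setIidPl JB); have -> : T :&: B = set0.
    by apply/disjoint_setI0; rewrite disjoint_sym; apply: disjointWr dBX.
  by rewrite setU0.
have JT x y : x \in J -> y \in T -> ~~ e x y.
  move=> xJ /TX; rewrite !inE => /andP[/existsPn/(_ x)]; rewrite xJ //.
apply/independentP => x y; rewrite !inE => /orP[xJ|xT] /orP[yJ|yT].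
- exact: (independentP _ iJ).
- exact: JT.
- by rewrite e_sym JT.
exact: (independentP _ iT).
Qed.

Lemma set_weight_delete u x Y : x \notin Y ->
  set_weight u (x |: Y) = set_weight u Y + u x * set_weight u (Y :\: nbhd [set x]).
Proof.
move=> xY; rewrite set_weight_split; last by rewrite disjoints1.
rewrite (bigD1 set0) /=; last by rewrite sub0set independent0.
rewrite big_set0 mul1r; have -> : nbhd set0 = set0.
  by apply/setP => z; rewrite !inE; apply/existsP => -[v]; rewrite inE.
rewrite setD0 (bigD1 [set x]) /=; last first.
  rewrite subxx -cards_eq0 cards1 andbT; apply/independentP => a b.
  by rewrite !inE => /eqP-> /eqP->; rewrite e_irr.
rewrite big_set1 big1 ?addr0 // => J.
by rewrite subset1; case: eqP; case: eqP => //=; rewrite ?andbF.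
Qed.

Lemma set_weight_clique u Y : clique e Y -> set_weight u Y = 1 + \sum_(y in Y) u y.
Proof.
have [n] := ubnP #|Y|; elim: n Y => // n IH Y; rewrite ltnS => Yn /cliqueP cY.
have [->|[x xY]] := set_0Vmem Y; first by rewrite set_weight0 big_set0 addr0.
rewrite -(setD1K xY) set_weight_delete ?setD11 // big_setU1 ?setD11 //= IH.
- have -> : Y :\ x :\: nbhd [set x] = set0.
    apply/setP => z; rewrite !inE; apply/negP => /and3P[/existsPn/(_ x)].
    by rewrite inE eqxx /= => exz zx zY; rewrite (cY x z) // eq_sym in exz.
  by rewrite set_weight0 mulr1 addrAC [in RHS]addrA.
- by apply: leq_trans Yn; rewrite [ltnRHS](cardsD1 x) xY.
by apply: cliqueS (subD1set _ _) _; apply/cliqueP.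
Qed.

(** By deletion of [x]: its non-neighbours form a clique, because two nonadjacent ones would
    complete an independent triple. *)
Lemma set_weight_small u Y : small e Y -> set_weight u Y = small_weight u Y.
Proof.
have [n] := ubnP #|Y|; elim: n Y => // n IH Y; rewrite ltnS => Yn sY.
have [->|[x xY]] := set_0Vmem Y; first by rewrite set_weight0 /small_weight
  big_set0 addr0.
have c_sym a b : compl_graph e a b = compl_graph e b a.
  by rewrite /compl_graph /= eq_sym e_sym.
rewrite -(setD1K xY) set_weight_delete ?setD11 // /small_weight big_setU1 ?setD11
  //= IH; first last.
- exact: smallS (subD1set _ _) sY.
- by apply: leq_trans Yn; rewrite [ltnRHS](cardsD1 x) xY.
set Y' := Y :\ x; have xY' : x \notin Y' by rewrite setD11.
have DE : Y' :\: nbhd [set x] = [set y in Y' | compl_graph e x y].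
  apply/setP => y; rewrite [LHS]inE [RHS]inE andbC; case yY : (y \in Y') => //=.
  rewrite /compl_graph /= inE.
  have -> /= : x != y by apply: contraNneq xY' => ->.
  congr (~~ _); apply/existsP/idP => [[v]|exy]; first by rewrite inE => /andP[/eqP->].
  by exists x; rewrite inE eqxx.
rewrite DE set_weight_clique; last first.
  apply/cliqueP => a b; rewrite !inE /compl_graph /=.
  move=> /andP[/andP[_ aY] /andP[xa exa]] /andP[/andP[_ bY] /andP[xb exb]] ab.
  have := smallP _ _ sY x a b xY aY bY xa ab xb.
  by rewrite (negPf exa) (negPf exb) orbF.
have sE z : \sum_(y in x |: Y' | compl_graph e z y) u y =
   (if compl_graph e z x then u x else 0) + \sum_(y in Y' | compl_graph e z y) u y.
  by rewrite big_mkcondr /= big_setU1 //= -big_mkcondr.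
have cxx : compl_graph e x x = false by rewrite /compl_graph /= eqxx.
rewrite sE cxx add0r.
(* Half of each pair containing [x] comes from the term of [x], the other half from the term of its
   partner. *)
have -> : \sum_(z in Y') u z * (1 + 2^-1 * \sum_(y in x |: Y' | compl_graph e z y)
  u y) =
   \sum_(z in Y') u z * (2^-1 * (if compl_graph e z x then u x else 0)) +
   \sum_(z in Y') u z * (1 + 2^-1 * \sum_(y in Y' | compl_graph e z y) u y).
  by rewrite -big_split /=; apply: eq_bigr => z _; rewrite sE; ring.
have -> : \sum_(i in Y') u i * (2^-1 * (if compl_graph e i x then u x else 0)) =
   2^-1 * u x * \sum_(y in Y' | compl_graph e x y) u y.
  rewrite big_mkcondr /= big_distrr /=; apply: eq_bigr => z _; rewrite c_sym.
  by case: ifP => _; ring.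
rewrite (eq_bigl (fun y => (y \in Y') && compl_graph e x y)); last by move=> y;
  rewrite inE.
set a := \sum_(y in Y' | _) _; set b := \sum_(i in Y') _.
have -> : small_weight u Y' = 1 + b by [].
by field.
Qed.

Lemma set_weight_elim u A X B : (forall v, 0 <= u v) -> X \subset A -> B \subset A
  :\: X ->
  {in B &, forall p q, p != q -> nbhd [set p] :&: X != set0 ->
     nbhd [set q] :&: X != set0 -> e p q} ->
  set_weight u (B :|: X) = set_weight u X * set_weight (elim_weight u A X) B.
Proof.
move=> u0 XA BA cB; have Z0 : set_weight u X != 0 by rewrite gt_eqF // set_weight_gt0.
rewrite set_weight_split; last first.
  rewrite disjoint_subset; apply/subsetP => b /(subsetP BA); rewrite !inE.
  by case/andP.
rewrite [X in _ * X]/set_weight big_distrr /=; apply: eq_bigr => J /andP[JB iJ].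
have -> : \prod_(v in J) elim_weight u A X v =
    \prod_(v in J) u v * \prod_(v in J) (set_weight u (X :\: nbhd [set v]) /
      set_weight u X).
  rewrite -big_split /=; apply: eq_bigr => v vJ.
  by rewrite /elim_weight (subsetP BA _ (subsetP JB _ vJ)) mulrA.
rewrite mulrCA; congr (_ * _).
have nbr0 v : nbhd [set v] :&: X = set0 -> X :\: nbhd [set v] = X.
  move=> E; apply/setDidPl; by rewrite disjoint_sym -setI_eq0 E.
(* A ratio differs from 1 only at a vertex with a neighbour in [X]. If [J] has such a vertex [p], it
   is unique, and [nbhd J] meets [X] exactly in the neighbours of [p]. *)
have [/forall_inP none|] := boolP [forall v in J, nbhd [set v] :&: X == set0].
  have -> : X :\: nbhd J = X.
    apply/setDidPl; rewrite disjoint_subset; apply/subsetP => z zX; rewrite !inE.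
    apply/existsP => -[v /andP[vJ evz]]; have /eqP/setP/(_ z) := none v vJ.
    by rewrite !inE zX andbT => /existsP[]; exists v; rewrite inE eqxx.
  rewrite big1 ?mulr1 // => v vJ; rewrite nbr0 ?divff //; exact/eqP/none.
case/forall_inPn => p pJ pX; have uniq q : q \in J -> q != p -> nbhd [set q] :&: X
  = set0.
  move=> qJ qp; apply/eqP; apply: contraT => qX.
  have := cB q p (subsetP JB _ qJ) (subsetP JB _ pJ) qp qX pX.
  by rewrite (negPf (independentP _ iJ q p qJ pJ)).
rewrite (bigD1 p) //= big1 ?mulr1; last first.
  by move=> q /andP[qJ qp]; rewrite nbr0 ?divff // uniq.
rewrite mulrCA divff // mulr1; congr (set_weight u _).
apply/setP => z; rewrite !inE; case zX : (z \in X); rewrite ?andbF // !andbT.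
congr (~~ _); apply/existsP/existsP => -[v /andP[]].
  move=> vJ evz; exists p; rewrite inE eqxx /=.
  have [<-//|vp] := eqVneq v p; have /setP/(_ z) := uniq v vJ vp.
  rewrite !inE zX andbT => /existsP[]; exists v; by rewrite inE eqxx.
by rewrite inE => /eqP-> epz; exists p; rewrite pJ.
Qed.

End Counting.

(** * The algorithm and its running time *)

Definition enc_rel (V : finType) (e : rel V) : tree :=
  enc_fun (fun x => enc_fun (fun y => enc_bool (e x y))).

Definition enc_weights (V : finType) (u : V -> rat) : tree :=
  enc_fun (fun v => enc_rat (u v)).

Section Vertices.
Variables (I : Type) (X : I -> tree) (V : I -> finType) (e : forall i, rel (V i)).
Hypothesis he : ptime X (fun i => enc_rel (@e i)).
Let Xv (j : {i & V i}) := Node (X (tag j)) (enc_vertex (tagged j)).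

Lemma ptime_weak_vertex (Y : I -> tree) : ptime X Y -> ptime Xv (fun j => Y (tag j)).
Proof. exact: (ptime_weak (T := V) (fun i => @enc_vertex (V i))). Qed.

Lemma ptime_this_vertex : ptime Xv (fun j => enc_vertex (tagged j)).
Proof. exact: (ptime_tagged X (T := V) (fun i => @enc_vertex (V i))). Qed.

Lemma ptime_vertices : ptime X (fun i => enc_fun (@enc_vertex (V i))).
Proof. exact: ptime_enum he. Qed.

Lemma ptime_adj (x y : forall i, V i) :
  ptime X (fun i => enc_vertex (x i)) -> ptime X (fun i => enc_vertex (y i)) ->
  ptime X (fun i => enc_bool (e (x i) (y i))).
Proof.
move=> hx hy; have h := ptime_lookup (f := fun i x => enc_fun (fun y => enc_bool (e
  x y))) he hx.
exact: (ptime_lookup (f := fun i y => enc_bool (e (x i) y)) h hy).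
Qed.

Lemma ptime_compl (x y : forall i, V i) :
  ptime X (fun i => enc_vertex (x i)) -> ptime X (fun i => enc_vertex (y i)) ->
  ptime X (fun i => enc_bool (compl_graph (@e i) (x i) (y i))).
Proof.
by move=> hx hy; apply: ptime_and (ptime_neg _) (ptime_neg _);
  [apply: ptime_vertex_eq|apply: ptime_adj].
Qed.

Lemma ptime_sum (f : forall i, V i -> rat) : (forall i v, 0 <= f i v) ->
  ptime Xv (fun j => enc_rat (f _ (tagged j))) ->
  ptime X (fun i => enc_rat (\sum_v f i v)).
Proof.
move=> f0 hf; have h := ptime_tab ptime_vertices (f := fun i v => enc_rat (f i v)) hf.
have l0 i : all (>= 0) [seq f i v | v <- enum (V i)].
  by apply/allP => _ /mapP[v _ ->].
apply: eq_ptime (ptime_sumq (X := X) l0 _) _ => [|i].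
  by apply: eq_ptime h _ => i; rewrite -map_comp.
by rewrite big_map big_enum.
Qed.

End Vertices.

Lemma ptime_weak_rel I (X : I -> tree) (V : I -> finType) (e : forall i, rel (V i)) :
  ptime X (fun i => enc_rel (@e i)) ->
  ptime (fun j : {i & V i} => Node (X (tag j)) (enc_vertex (tagged j)))
        (fun j => enc_rel (@e (tag j))).
Proof. exact: ptime_weak_vertex. Qed.

Section Step.
Variables (I : Type) (X : I -> tree) (V : I -> finType) (e : forall i, rel (V i)).
Hypothesis he : ptime X (fun i => enc_rel (@e i)).
Variables (A H : forall i, {set V i}).
Hypotheses (hA : ptime X (fun i => enc_set (A i))) (hH : ptime X (fun i => enc_set
  (H i))).

Lemma ptime_seed (x y : forall i, V i) :
  ptime X (fun i => enc_vertex (x i)) -> ptime X (fun i => enc_vertex (y i)) ->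
  ptime X (fun i => enc_set (seed (@e i) (A i) (x i) (y i))).
Proof.
move=> hx hy; apply: (ptime_set (ptime_vertices he)).
have hz := ptime_this_vertex X V; have he' := ptime_weak_rel he.
have hx' := ptime_weak_vertex V hx; have hy' := ptime_weak_vertex V hy.
apply: ptime_and; first exact: ptime_in (ptime_weak_vertex V hA) hz.
apply: ptime_or; first exact: ptime_vertex_eq hz hx'.
apply: ptime_or; first exact: ptime_vertex_eq hz hy'.
apply: ptime_and; [exact (ptime_adj he' hx' hz)|exact (ptime_adj he' hy' hz)].
Qed.

Lemma ptime_grow : ptime X (fun i => enc_set (grow (@e i) (A i) (H i))).
Proof.
apply: (ptime_set (ptime_vertices he)).
have v0 := ptime_this_vertex X V; have e0 := ptime_weak_rel he.
have A0 := ptime_weak_vertex V hA; have H0 := ptime_weak_vertex V hH.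
apply: ptime_or; first exact: ptime_in H0 v0.
apply: ptime_and; first exact: ptime_in A0 v0.
apply: (ptime_exists (ptime_vertices e0)).
(* Each quantifier extends the environment; [V1], [V2], [V3] are the vertex types over these
   extensions, and the final digit of a hypothesis is the depth of its environment. *)
pose V1 (j : {i & V i}) := V (tag j).
have x1 := ptime_this_vertex (fun j : {i & V i} => Node (X (tag j)) (enc_vertex
  (tagged j))) V1.
have e1 := ptime_weak_rel e0.
have A1 := ptime_weak_vertex V1 A0; have H1 := ptime_weak_vertex V1 H0.
have v1 := ptime_weak_vertex V1 v0.
apply: (ptime_exists (ptime_vertices e1)).
pose V2 (j : {j : {i & V i} & V1 j}) := V1 (tag j).
have y2 := ptime_this_vertex (fun j : {j : {i & V i} & V1 j} =>
  Node (Node (X (tag (tag j))) (enc_vertex (tagged (tag j)))) (enc_vertex (tagged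
    j))) V2.
have e2 := ptime_weak_rel e1.
have A2 := ptime_weak_vertex V2 A1; have H2 := ptime_weak_vertex V2 H1.
have v2 := ptime_weak_vertex V2 v1; have x2 := ptime_weak_vertex V2 x1.
apply: (ptime_exists (ptime_vertices e2)).
pose V3 (j : {j : {j : {i & V i} & V1 j} & V2 j}) := V2 (tag j).
have u3 := ptime_this_vertex (fun j : {j : {j : {i & V i} & V1 j} & V2 j} =>
  Node (Node (Node (X (tag (tag (tag j)))) (enc_vertex (tagged (tag (tag j)))))
    (enc_vertex (tagged (tag j)))) (enc_vertex (tagged j))) V3.
have e3 := ptime_weak_rel e2.
have A3 := ptime_weak_vertex V3 A2; have H3 := ptime_weak_vertex V3 H2.
have v3 := ptime_weak_vertex V3 v2; have x3 := ptime_weak_vertex V3 x2.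
have y3 := ptime_weak_vertex V3 y2.
apply: ptime_and; first exact: ptime_in H3 x3.
apply: ptime_and; first exact: ptime_in H3 y3.
apply: ptime_and; first exact: ptime_in A3 u3.
apply: ptime_and; first exact (ptime_compl e3 x3 y3).
apply: ptime_and; first exact (ptime_adj e3 x3 v3).
apply: ptime_and; first exact (ptime_adj e3 u3 y3).
apply: ptime_or; first exact: ptime_vertex_eq v3 u3.
apply: ptime_and; first exact (ptime_adj e3 v3 u3).
apply: ptime_and; first exact (ptime_neg (ptime_adj e3 x3 u3)).
exact (ptime_neg (ptime_adj e3 v3 y3)).
Qed.

End Step.

Lemma enc_fun_size_le (V : finType) (f : V -> tree) n :
  (forall v, tree_size (f v) <= n)%N -> (tree_size (enc_fun f) <= (#|V| * n.+1).+1)%N.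
Proof.
move=> fn; rewrite tree_size_enc_seq ltnS size_map -cardE mulnS addnC leq_add2l.
rewrite cardE; elim: (enum V) => //= v l IH.
by rewrite mulSn leq_add.
Qed.

Lemma enc_set_size_le (V : finType) (A : {set V}) : (tree_size (enc_set A) <= (#|V|
  * 4).+1)%N.
Proof. by apply: enc_fun_size_le => v; case: (v \in A). Qed.

Lemma card_le_enc_fun (V : finType) (f : V -> tree) : (#|V| <= tree_size (enc_fun
  f))%N.
Proof. by rewrite cardE -(size_map f) size_enc_seq. Qed.

Section StepOperations.
Variables (I : Type) (X : I -> tree) (V : I -> finType) (e : forall i, rel (V i)).
Hypothesis he : ptime X (fun i => enc_rel (@e i)).

Lemma pbound_card : pbound X (fun i => #|V i|).
Proof. by apply: pbound_le (ptime_size he) _ => i; apply: card_le_enc_fun. Qed.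

Variables (A H : forall i, {set V i}).
Hypotheses (hA : ptime X (fun i => enc_set (A i))) (hH : ptime X (fun i => enc_set
  (H i))).

Lemma ptime_setD : ptime X (fun i => enc_set (A i :\: H i)).
Proof.
have v0 := ptime_this_vertex X V.
have A0 := ptime_weak_vertex V hA; have H0 := ptime_weak_vertex V hH.
apply: (eq_ptime (ptime_set (ptime_vertices he) (P := fun i v => (v \notin H i) &&
  (v \in A i)) _)).
  by apply: ptime_and; [apply/ptime_neg/(ptime_in H0 v0)|apply: ptime_in A0 v0].
by move=> i; congr enc_set; apply/setP => v; rewrite !inE.
Qed.

Lemma ptime_interior : ptime X (fun i => enc_set (interior (@e i) (A i) (H i))).
Proof.
apply: (ptime_set (ptime_vertices he)).
have v0 := ptime_this_vertex X V; have e0 := ptime_weak_rel he.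
have A0 := ptime_weak_vertex V hA; have H0 := ptime_weak_vertex V hH.
apply: ptime_and; first exact: ptime_in H0 v0.
apply: ptime_neg; apply: (ptime_exists (ptime_vertices e0)).
pose V1 (j : {i & V i}) := V (tag j).
have z1 := ptime_this_vertex (fun j : {i & V i} => Node (X (tag j)) (enc_vertex
  (tagged j))) V1.
have e1 := ptime_weak_rel e0; have v1 := ptime_weak_vertex V1 v0.
have A1 := ptime_weak_vertex V1 A0; have H1 := ptime_weak_vertex V1 H0.
apply: ptime_and; first exact: ptime_in A1 z1.
apply: ptime_and; first exact (ptime_adj e1 v1 z1).
exact: ptime_neg (ptime_in H1 z1).
Qed.

Lemma ptime_clique : ptime X (fun i => enc_bool (clique (@e i) (H i))).
Proof.
have v0 := ptime_this_vertex X V; have e0 := ptime_weak_rel he.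
have H0 := ptime_weak_vertex V hH.
pose V1 (j : {i & V i}) := V (tag j).
have z1 := ptime_this_vertex (fun j : {i & V i} => Node (X (tag j)) (enc_vertex
  (tagged j))) V1.
have e1 := ptime_weak_rel e0; have v1 := ptime_weak_vertex V1 v0.
have H1 := ptime_weak_vertex V1 H0.
pose P i (x y : V i) := ~~ [&& x \in H i, y \in H i, ~~ (x == y) & ~~ e x y].
apply: (eq_ptime (ptime_forall (ptime_vertices he) (P := fun i x => [forall y, P i
  x y]) _)).
  apply: (ptime_forall (ptime_vertices e0)); apply: ptime_neg.
  apply: ptime_and; first exact: ptime_in H1 v1.
  apply: ptime_and; first exact: ptime_in H1 z1.
  apply: ptime_and; first exact: ptime_neg (ptime_vertex_eq v1 z1).
  exact (ptime_neg (ptime_adj e1 v1 z1)).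
move=> i; congr enc_bool; apply: eq_forallb => x; rewrite /P.
case: (x \in H i) => /=; last by apply/forallP.
by apply: eq_forallb => y; case: (y \in H i); case: (x == y); case: (e x y).
Qed.

Lemma ptime_small : ptime X (fun i => enc_bool (small (@e i) (H i))).
Proof.
apply: ptime_neg; apply: (ptime_exists (ptime_vertices he)).
have x0 := ptime_this_vertex X V; have e0 := ptime_weak_rel he.
have H0 := ptime_weak_vertex V hH.
pose V1 (j : {i & V i}) := V (tag j).
have y1 := ptime_this_vertex (fun j : {i & V i} => Node (X (tag j)) (enc_vertex
  (tagged j))) V1.
have e1 := ptime_weak_rel e0; have x1 := ptime_weak_vertex V1 x0.
have H1 := ptime_weak_vertex V1 H0.
apply: (ptime_exists (ptime_vertices e0)).
pose V2 (j : {j : {i & V i} & V1 j}) := V1 (tag j).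
have z2 := ptime_this_vertex (fun j : {j : {i & V i} & V1 j} =>
  Node (Node (X (tag (tag j))) (enc_vertex (tagged (tag j)))) (enc_vertex (tagged
    j))) V2.
have e2 := ptime_weak_rel e1; have H2 := ptime_weak_vertex V2 H1.
have x2 := ptime_weak_vertex V2 x1; have y2 := ptime_weak_vertex V2 y1.
apply: (ptime_exists (ptime_vertices e1)).
apply: ptime_and; first exact: ptime_in H2 x2.
apply: ptime_and; first exact: ptime_in H2 y2.
apply: ptime_and; first exact: ptime_in H2 z2.
apply: ptime_and; first exact (ptime_compl e2 x2 y2).
by apply: ptime_and; [exact (ptime_compl e2 y2 z2)|exact (ptime_compl e2 x2 z2)].
Qed.

Variable u : forall i, V i -> rat.
Arguments u {i}.
Hypotheses (u_ge0 : forall i (v : V i), 0 <= u v).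
Hypothesis (hu : ptime X (fun i => enc_weights (@u i))).

Lemma small_weight_ge1 i (Y : {set V i}) : 1 <= small_weight (@e i) u Y.
Proof.
rewrite /small_weight lerDl; apply: sumr_ge0 => x _; rewrite mulr_ge0 //.
by rewrite addr_ge0 // mulr_ge0 // ?invr_ge0 //; apply: sumr_ge0.
Qed.

Lemma ptime_small_weight : ptime X (fun i => enc_rat (small_weight (@e i) u (H i))).
Proof.
(* Restricted sums become sums over all vertices, with 0 outside the range. *)
pose f i x (y : V i) := if (y \in H i) && compl_graph (@e i) x y then u y else 0.
pose g i (x : V i) := if x \in H i then u x * (1 + 2^-1 * \sum_y f i x y) else 0.
have f0 i x y : 0 <= f i x y by rewrite /f; case: ifP.
have fs0 i x : 0 <= \sum_y f i x y by apply: sumr_ge0.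
have g0 i x : 0 <= g i x.
  by rewrite /g; case: ifP => // _; rewrite mulr_ge0 // addr_ge0 // mulr_ge0 //
    invr_ge0.
apply: (eq_ptime (Y := fun i => enc_rat (1 + \sum_x g i x))); last first.
  move=> i; congr enc_rat; rewrite /small_weight [in RHS]big_mkcond /=; congr (_ + _).
  apply: eq_bigr => x _; rewrite /g; case: ifP => // _; congr (_ * (_ + _ * _)).
  by rewrite /f -big_mkcond.
have half0 : 0 <= 2^-1 :> rat by rewrite invr_ge0.
have h0 i x : 0 <= 2^-1 * \sum_y f i x y by apply: mulr_ge0.
have h1 i x : 0 <= 1 + 2^-1 * \sum_y f i x y by apply: addr_ge0.
apply: ptime_addq; first by [].
- by move=> i; apply: sumr_ge0.
- exact: ptime_const.
apply: (ptime_sum he g0).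
have v0 := ptime_this_vertex X V; have e0 := ptime_weak_rel he.
have H0 := ptime_weak_vertex V hH; have u0 := ptime_weak_vertex V hu.
apply: ptime_rat_if; [exact: ptime_in H0 v0| |exact: (ptime_const _ (enc_rat 0))].
have ux := ptime_lookup (f := fun (j : {i & V i}) (v : V (tag j)) => enc_rat (u v))
  u0 v0.
apply: (ptime_mulq (fun j : {i & V i} => u_ge0 (tagged j)) (fun j : {i & V i} => h1
  _ (tagged j))) => //.
apply: (ptime_addq _ (fun j : {i & V i} => h0 _ (tagged j))); first by [].
  exact: (ptime_const _ (enc_rat 1)).
apply: (ptime_mulq _ (fun j : {i & V i} => fs0 _ (tagged j))); first by [].
  exact: (ptime_const _ (enc_rat 2^-1)).
apply: (ptime_sum e0); first by move=> j; apply: f0.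
pose V1 (j : {i & V i}) := V (tag j).
have y1 := ptime_this_vertex (fun j : {i & V i} => Node (X (tag j)) (enc_vertex
  (tagged j))) V1.
have e1 := ptime_weak_rel e0; have x1 := ptime_weak_vertex V1 v0.
have H1 := ptime_weak_vertex V1 H0; have u1 := ptime_weak_vertex V1 u0.
apply: ptime_rat_if; last exact: (ptime_const _ (enc_rat 0)).
  by apply: ptime_and; [exact: ptime_in H1 y1|exact (ptime_compl e1 x1 y1)].
exact (ptime_lookup (f := fun (j : {j : {i & V i} & V1 j}) (v : V1 (tag j)) =>
  enc_rat (u v)) u1 y1).
Qed.

End StepOperations.

Lemma foldl_iter (T S : Type) (f : S -> S) (l : seq T) s :
  foldl (fun s _ => f s) s l = iter (size l) f s.
Proof. by elim: l s => //= x l IH s; rewrite IH -iterSr. Qed.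

Lemma ptime_hull I (X : I -> tree) (V : I -> finType) (e : forall i, rel (V i))
    (A : forall i, {set V i}) (x y : forall i, V i) :
  ptime X (fun i => enc_rel (@e i)) -> ptime X (fun i => enc_set (A i)) ->
  ptime X (fun i => enc_vertex (x i)) -> ptime X (fun i => enc_vertex (y i)) ->
  ptime X (fun i => enc_set (hull (@e i) (A i) (x i) (y i))).
Proof.
move=> he hA hx hy.
pose st i (s : {set V i}) (_ : V i) := grow (@e i) (A i) s.
apply: (eq_ptime (Y := fun i => enc_set (foldl (@st i) (seed (@e i) (A i) (x i) (y i))
  (enum (V i))))); last first.
  by move=> i; rewrite foldl_iter -cardE.
apply: (ptime_foldl_inv (S := fun i => {set V i}) (eS := fun i => @enc_set (V i))
  (eT := fun i => @enc_vertex (V i)) (L := fun i => enum (V i)) (step := st)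
  (Inv := fun _ _ => True) (b := fun i => (#|V i| * 4).+1)) => //.
- exact: ptime_vertices he.
- exact: ptime_seed.
- by have := pbound_card he => ?; pbound_tac.
- by move=> i s _; apply: enc_set_size_le.
set C := fun j => Node (Node _ _) _; have id := ptime_id C.
have hX := ptime_fst (ptime_fst id).
apply: ptime_grow; last exact: ptime_snd (ptime_fst id).
- exact: ptime_trans hX (ptime_reindex (fun j => tag (tag j)) he).
exact: ptime_trans hX (ptime_reindex (fun j => tag (tag j)) hA).
Qed.

(* The remaining vertices, their current weights, and the factor collected from
   the eliminated ones. *)
Definition state (V : finType) : Type := {set V} * (V -> rat) * rat.

Definition enc_state (V : finType) (s : state V) : tree :=
  Node (enc_set s.1.1) (Node (enc_weights s.1.2) (enc_rat s.2)).

(** * The elimination procedure *)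

Section Step.
Variables (V : finType) (e : rel V).

(** An empty interior is harmless: its weight is 1, and no vertex or factor changes. *)
Definition elim_step (s : state V) (x y : V) : state V :=
  let A := s.1.1 in let u := s.1.2 in
  let H := hull e A x y in let X := interior e A H in
  if eliminable e A H then
    (A :\: X,
     fun v => if v \in A :\: X then
       u v * small_weight e u [set z in X | ~~ e v z] / small_weight e u X else 0,
     s.2 * small_weight e u X)
  else s.

Definition elim_round (s : state V) : state V :=
  foldl (fun s x => foldl (fun s y => elim_step s x y) s (enum V)) s (enum V).

(** The list [enum V] only counts: one round per vertex. *)
Definition elim_all (w : V -> rat) : state V :=
  foldl (fun s _ => elim_round s) (setT, w, 1) (enum V).

End Step.

Section PtimeStep.
Variables (I : Type) (X : I -> tree) (V : I -> finType) (e : forall i, rel (V i)).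
Variables (s : forall i, state (V i)) (x y : forall i, V i).
Hypothesis he : ptime X (fun i => enc_rel (@e i)).
Hypothesis hs : ptime X (fun i => enc_state (s i)).
Hypotheses (hx : ptime X (fun i => enc_vertex (x i))) (hy : ptime X (fun i =>
  enc_vertex (y i))).
Hypotheses (u_ge0 : forall i v, 0 <= (s i).1.2 v) (F_ge0 : forall i, 0 <= (s i).2).

Lemma ptime_elim_step : ptime X (fun i => enc_state (elim_step (@e i) (s i) (x i)
  (y i))).
Proof.
have hA : ptime X (fun i => enc_set (s i).1.1) := ptime_fst hs.
have hu : ptime X (fun i => enc_weights (s i).1.2) := ptime_fst (ptime_snd hs).
have hF : ptime X (fun i => enc_rat (s i).2) := ptime_snd (ptime_snd hs).
pose H i := hull (@e i) (s i).1.1 (x i) (y i).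
pose Y i := interior (@e i) (s i).1.1 (H i).
have hH : ptime X (fun i => enc_set (H i)) := ptime_hull he hA hx hy.
have hY : ptime X (fun i => enc_set (Y i)) := ptime_interior he hA hH.
have hAY : ptime X (fun i => enc_set ((s i).1.1 :\: Y i)) := ptime_setD he hA hY.
have hHY : ptime X (fun i => enc_set (H i :\: Y i)) := ptime_setD he hH hY.
have hc : ptime X (fun i => enc_bool (eliminable (@e i) (s i).1.1 (H i))).
  exact (ptime_and (ptime_clique he hHY) (ptime_small he hH)).
have ge1 i Z := small_weight_ge1 (@e) u_ge0 (i := i) Z.
have gt0 i Z : 0 < small_weight (@e i) (s i).1.2 Z by apply: lt_le_trans (ge1 i Z).
have hZ := ptime_small_weight he hY u_ge0 hu.
have h1 := ptime_mulq F_ge0 (fun i => ltW (gt0 i (Y i))) hF hZ.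
pose u' i v := if v \in (s i).1.1 :\: Y i then
  (s i).1.2 v * small_weight (@e i) (s i).1.2 [set z in Y i | ~~ e v z] /
  small_weight (@e i) (s i).1.2 (Y i) else 0.
have hu' : ptime X (fun i => enc_weights (@u' i)).
  apply: (ptime_tab (ptime_vertices he)).
  have v0 := ptime_this_vertex X V; have e0 := ptime_weak_rel he.
  have Y0 := ptime_weak_vertex V hY; have u0 := ptime_weak_vertex V hu.
  have AY0 := ptime_weak_vertex V hAY; have Z0 := ptime_weak_vertex V hZ.
  apply: ptime_rat_if; [exact: ptime_in AY0 v0| |exact: (ptime_const _ (enc_rat 0))].
  have u0' (j : {i & V i}) (v : V (tag j)) : 0 <= (s (tag j)).1.2 v by [].
  have gtj (j : {i & V i}) := gt0 (tag j).
  apply: (ptime_divq _ (fun j => gtj j (Y (tag j))) _ Z0).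
    by move=> j; apply: mulr_ge0 => //; apply/ltW/gtj.
  apply: (ptime_mulq (fun j : {i & V i} => u0' j (tagged j)) (fun j => ltW (gtj j
    _))).
    exact: (ptime_lookup (f := fun (j : {i & V i}) (v : V (tag j)) => enc_rat ((s
      (tag j)).1.2 v)) u0 v0).
  apply: (ptime_small_weight e0 _ u0' u0); apply: (ptime_set (ptime_vertices e0)).
  pose V1 (j : {i & V i}) := V (tag j).
  have z1 := ptime_this_vertex (fun j : {i & V i} => Node (X (tag j)) (enc_vertex
    (tagged j))) V1.
  have e1 := ptime_weak_rel e0; have v1 := ptime_weak_vertex V1 v0.
  have Y1 := ptime_weak_vertex V1 Y0.
  by apply: ptime_and; [exact: ptime_in Y1 z1|exact (ptime_neg (ptime_adj e1 v1 z1))].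
apply: eq_ptime (ptime_if_bool hc (ptime_node hAY (ptime_node hu' h1)) hs) _ => i.
by rewrite /elim_step -/(H i) -/(Y i); case: ifP.
Qed.

End PtimeStep.

Lemma foldl_inv (T S : Type) (P : S -> Prop) (f : S -> T -> S) l s0 :
  P s0 -> (forall s x, P s -> P (f s x)) -> P (foldl f s0 l).
Proof. move=> P0 Pf; elim: l s0 P0 => //= x l IH s0 P0; exact/IH/Pf. Qed.

(** * Exactness and termination of the elimination *)

Section Correctness.
Variables (V : finType) (e : rel V) (w : V -> rat).
Hypotheses (e_sym : symmetric e) (e_irr : irreflexive e) (w_ge0 : forall v, 0 <= w v).
Implicit Types (A B X : {set V}) (s : state V).

(** Quantifying over [B] makes the invariant reproduce itself, since a step uses it for [B :|: X].
    The zero weights outside the remaining set keep the table short, as it still has an entry for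
    every vertex. *)
Definition elim_inv s : Prop :=
  [/\ forall v, 0 <= s.1.2 v, forall v, v \notin s.1.1 -> s.1.2 v = 0, 0 < s.2
    & forall B, B \subset s.1.1 ->
        s.2 * set_weight e s.1.2 B = set_weight e w (B :|: ~: s.1.1)].

Lemma elim_inv_init : elim_inv (setT, w, 1).
Proof.
split=> //= [v|B _]; first by rewrite inE.
by rewrite setCT setU0 mul1r.
Qed.

(** An interior vertex has no neighbour in [A] outside [H]. *)
Lemma interior_nbr A H X v : X = interior e A H -> v \in A :\: X ->
  nbhd e [set v] :&: X != set0 -> v \in H :\: X.
Proof.
move=> -> /setDP[vA vX] /set0Pn[z]; rewrite !inE => /andP[/existsP[v']].
rewrite inE => /andP[/eqP-> evz] /andP[zH /existsPn/(_ v)].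
rewrite vA e_sym evz /= negbK => vH.
by move: vX; rewrite inE => ->; rewrite vH.
Qed.

(** The test [eliminable] suffices: its clique contains all remaining neighbours of [X], and its
    smallness makes [small_weight] the true weight of [X] and its subsets. *)
Lemma elim_step_inv s x y : elim_inv s -> elim_inv (elim_step e s x y).
Proof.
case: s => [[A u] F] [/= u0 uA F0 FE]; rewrite /elim_step /=.
set H := hull e A x y; set X := interior e A H; case: ifP => // /andP[cH sH].
have XH : X \subset H by apply/subsetP => z; rewrite inE => /andP[].
have HA : H \subset A.
  rewrite /H; apply: hull_sub => [|K KA]; apply/subsetP => z; rewrite inE.
    by case/andP.
  by case/orP=> [/(subsetP KA)|/andP[]].
have sX : small e X by apply: smallS sH.
have ZE : small_weight e u X = set_weight e u X by rewrite set_weight_small.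
have Z0 : 0 < set_weight e u X by apply: set_weight_gt0.
have uE : (fun v => if v \in A :\: X then
    u v * small_weight e u [set z in X | ~~ e v z] / small_weight e u X else 0)
    =1 elim_weight e u A X.
  move=> v; rewrite /elim_weight ZE; case: ifP => // _.
  have -> : [set z in X | ~~ e v z] = X :\: nbhd e [set v].
    apply/setP => z; rewrite !inE andbC; congr (_ && _); congr (~~ _).
    apply/idP/existsP => [evz|[v']]; first by exists v; rewrite inE eqxx.
    by rewrite inE => /andP[/eqP->].
  by rewrite (@set_weight_small _ _ _ _ _ (X :\: _)) // (smallS (subsetDl _ _) sX).
split=> /= [v|v vAX| |B BA].
- by rewrite uE; apply: elim_weight_ge0.
- by rewrite (negPf vAX).
- by rewrite ZE mulr_gt0.
rewrite (@eq_set_weight _ _ _ (elim_weight e u A X)) => [|v _]; last exact: uE.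
rewrite ZE -mulrA -set_weight_elim //; last first.
- move=> p q pB qB pq pX qX.
  have := interior_nbr (erefl X) (subsetP BA _ pB) pX.
  have := interior_nbr (erefl X) (subsetP BA _ qB) qX.
  by move=> qH pH; apply: (cliqueP _ _ cH).
- exact: subset_trans XH HA.
rewrite FE; last first.
  by rewrite subUset (subset_trans XH HA) andbT (subset_trans BA) // subsetDl.
congr (set_weight e w _); apply/setP => z; rewrite !(in_setU, in_setC, in_setD).
by case: (z \in X); case: (z \in B); case: (z \in A).
Qed.

Lemma elim_round_inv s : elim_inv s -> elim_inv (elim_round e s).
Proof.
move=> Is; apply: foldl_inv => // {Is}s x Is; apply: foldl_inv => // {Is}s y Is.
exact: elim_step_inv.
Qed.

Lemma elim_all_inv : elim_inv (elim_all e w).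
Proof.
apply: foldl_inv; first exact: elim_inv_init.
by move=> s _; apply: elim_round_inv.
Qed.

Lemma elim_step_sub s x y : (elim_step e s x y).1.1 \subset s.1.1.
Proof. by rewrite /elim_step; case: ifP => //= _; apply: subsetDl. Qed.

Lemma foldl_elim_step_sub l s :
  (foldl (fun s p => elim_step e s p.1 p.2) s l).1.1 \subset s.1.1.
Proof.
elim: l s => //= p l IH s; exact: subset_trans (IH _) (elim_step_sub _ _ _).
Qed.

(** The test depends only on the remaining set. So either an earlier pair has already shrunk this
    set, or it is unchanged when [(x, y)] is reached, and that pair shrinks it. *)
Lemma foldl_elim_step_proper l s x y : (x, y) \in l ->
  eliminable e s.1.1 (hull e s.1.1 x y) -> interior e s.1.1 (hull e s.1.1 x y) !=
    set0 ->
  (foldl (fun s p => elim_step e s p.1 p.2) s l).1.1 \proper s.1.1.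
Proof.
elim: l s => //= p l IH s; rewrite inE => xyl el nz.
have [E|ne] := eqVneq (elim_step e s p.1 p.2).1.1 s.1.1; last first.
  apply: sub_proper_trans (foldl_elim_step_sub _ _) _.
  by rewrite properEneq ne elim_step_sub.
case/orP: xyl => [/eqP pE|xyl]; last by rewrite -E; apply: IH; rewrite ?E.
have := E; rewrite -pE /elim_step /= el /= => D; case/set0Pn: nz => z zI.
have zH : z \in hull e s.1.1 x y by move: zI; rewrite inE => /andP[].
have : z \in s.1.1.
  have HA : hull e s.1.1 x y \subset s.1.1.
    apply: hull_sub => [|K KA]; apply/subsetP => t; rewrite inE; first by case/andP.
    by case/orP=> [/(subsetP KA)|/andP[]].
  exact: (subsetP HA).
by rewrite -{1}D inE zI.
Qed.

Lemma elim_roundE s :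
  elim_round e s = foldl (fun s p => elim_step e s p.1 p.2) s
    [seq (x, y) | x <- enum V, y <- enum V].
Proof.
have H (l1 l2 : seq V) : foldl (fun s x => foldl (fun s y => elim_step e s x y) s
  l2) s l1 =
    foldl (fun s p => elim_step e s p.1 p.2) s [seq (x, y) | x <- l1, y <- l2].
  elim: l1 s => //= x l IH s; rewrite IH foldl_cat; congr foldl.
  by elim: l2 s {IH} => //= y l2 IH s; rewrite IH.
exact: H.
Qed.

Lemma elim_all_empty : leafy e setT -> (elim_all e w).1.1 = set0.
Proof.
move=> lV; rewrite /elim_all foldl_iter -cardE.
have round s : (#|(elim_round e s).1.1| <= #|s.1.1|.-1)%N.
  have [E|nE] := eqVneq s.1.1 set0.
    have := foldl_elim_step_sub [seq (x, y) | x <- enum V, y <- enum V] s.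
    by rewrite -elim_roundE E subset0 => /eqP->; rewrite cards0.
  have [x [y /andP[el nz]]] := exists_eliminable e_sym lV nE.
  rewrite elim_roundE -ltnS; apply: leq_trans (proper_card _) (leqSpred _).
  apply: foldl_elim_step_proper el nz.
  by apply/allpairsP; exists (x, y); rewrite !mem_enum.
suff H n : (#|(iter n (elim_round e) (setT, w, 1%R)).1.1| <= #|V| - n)%N.
  by apply/eqP; rewrite -cards_eq0 -leqn0 (leq_trans (H _)) ?subnn.
elim: n => [|n IH] /=; first by rewrite subn0 max_card.
by apply: leq_trans (round _) _; rewrite subnS -!subn1 leq_sub2r.
Qed.

Lemma elim_all_correct : leafy e setT -> (elim_all e w).2 = indep_weight e w.
Proof.
move=> lV; case: elim_all_inv => _ _ _ /(_ set0 (sub0set _)).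
rewrite set_weight0 mulr1 (elim_all_empty lV) setC0 setUT => ->.
by apply: eq_bigl => S; rewrite subsetT.
Qed.

End Correctness.

Lemma tree_size_enc_fun (V : finType) (f : V -> tree) :
  tree_size (enc_fun f) = ((\sum_v tree_size (f v))%N + #|V|).+1%N.
Proof. by rewrite tree_size_enc_seq size_map -cardE -map_comp sumnE big_map
  big_enum. Qed.

(** * Size of the intermediate rationals *)

Section SizeBounds.
Variables (V : finType) (e : rel V) (w : V -> rat).
Hypotheses (e_sym : symmetric e) (e_irr : irreflexive e) (w_ge0 : forall v, 0 <= w v).

Let Q := (\prod_v denn (w v))%N.
Let M := (\prod_v height (w v))%N.

Lemma weight_den_gt0 : (0 < Q)%N.
Proof. by rewrite prodn_gt0 // => v; apply: denn_gt0. Qed.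

Lemma weight_den_le : (Q <= M)%N.
Proof. by apply: leq_prod => v _; apply: leq_addl. Qed.

(** Over the common denominator [Q], a set [S] contributes numerators on [S] and denominators off
    [S]. Without the restriction on [S], these products sum to the expansion of [M]. *)
Lemma set_weight_frac (A : {set V}) :
  exists2 m, (m <= M)%N & set_weight e w A = m%:R / Q%:R.
Proof.
pose f (S : {set V}) v := if v \in S then numn (w v) else denn (w v).
exists (\sum_(S : {set V} | (S \subset A) && independent e S) \prod_v f S v)%N.
  rewrite /M bigA_distr [leqLHS]big_mkcond /=.
  by apply: leq_sum => S _; case: ifP.
rewrite natr_sum mulr_suml; apply: eq_bigr => S _.
rewrite !natr_prod -prodf_div big_mkcond /=; apply: eq_bigr => v _; rewrite /f.
case: ifP => _; first by rewrite -nnrat_frac.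
by rewrite divff // pnatr_eq0 -lt0n denn_gt0.
Qed.

(** The invariant at the empty set gives [F = m0 / Q], and at [[set v]] it gives
    [F * (1 + u v) = m1 / Q]. Hence [u v = (m1 - m0) / m0], of height at most [m1]. *)
Lemma height_state_weight s : elim_inv e w s ->
  (height s.2 <= 2 * M)%N /\ forall v, (height (s.1.2 v) <= 2 * M)%N.
Proof.
case: s => -[A u] F [/= u0 uA F0 FE].
have M0 : (0 < M)%N := leq_trans weight_den_gt0 weight_den_le.
have Q0 : Q%:R != 0 :> rat by rewrite pnatr_eq0 -lt0n weight_den_gt0.
have [m0 m0M] := set_weight_frac (set0 :|: ~: A).
rewrite -FE ?sub0set // set_weight0 mulr1 => Fm.
split.
  rewrite Fm; apply: leq_trans (height_frac _ weight_den_gt0) _.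
  by rewrite mul2n -addnn leq_add // weight_den_le.
move=> v; have [vA|nvA] := boolP (v \in A); last first.
  by rewrite uA // (leq_trans M0) // leq_pmull.
have [m1 m1M] := set_weight_frac ([set v] :|: ~: A).
rewrite -FE ?sub1set // set_weight_clique //; last first.
  by apply/cliqueP => x y; rewrite !inE => /eqP-> /eqP->; rewrite eqxx.
rewrite big_set1 Fm => /(congr1 (fun x => x * Q%:R)).
rewrite divfK // mulrAC divfK // => m01.
have m00 : 0 < m0%:R :> rat.
  have : 0 < m0%:R / Q%:R :> rat by rewrite -Fm.
  by rewrite pmulr_lgt0 // invr_gt0 ltr0n weight_den_gt0.
have le01 : (m0 <= m1)%N.
  by rewrite -(ler_nat rat) -m01 ler_peMr // ?lerDl // ltW.
have -> : u v = (m1 - m0)%N%:R / m0%:R.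
  by rewrite natrB // -m01; field; rewrite gt_eqF.
apply: leq_trans (height_frac _ _) _; first by rewrite -(ltr_nat rat).
by rewrite subnK // (leq_trans m1M) // leq_pmull.
Qed.

Let N := tree_size (enc_weighted_graph e w).

Lemma heights_le_exp : (M <= 2 ^ N)%N.
Proof.
apply: leq_trans (_ : \prod_v 2 ^ tree_size (enc_rat (w v)) <= _)%N.
  by apply: leq_prod => v _; apply: height_le_exp.
rewrite -expn_sum leq_exp2l //; apply: (@leq_trans (tree_size (enc_weights w))).
  by rewrite tree_size_enc_fun leqW // leq_addr.
by rewrite /N /=; apply: leqW; apply: leq_addl.
Qed.

Lemma enc_state_size_le s : elim_inv e w s ->
  (tree_size (enc_state s) <= (#|V| * 4).+1 + (#|V| * (32 * N.+1 + 43).+1).+1 +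
     (32 * N.+1 + 43) + 2)%N.
Proof.
move=> /height_state_weight[hF hu].
have sz x : (height x <= 2 * M -> tree_size (enc_rat x) <= 32 * N.+1 + 43)%N.
  move=> hx; apply: enc_rat_size_le; apply: leq_trans hx _.
  by rewrite expnS leq_mul2l heights_le_exp orbT.
have hA := enc_set_size_le s.1.1.
have hw : (tree_size (enc_weights s.1.2) <= (#|V| * (32 * N.+1 + 43).+1).+1)%N.
  exact: enc_fun_size_le (fun v => sz _ (hu v)).
have hF' := sz _ hF.
have -> : tree_size (enc_state s) = (tree_size (enc_set s.1.1) +
  (tree_size (enc_weights s.1.2) + tree_size (enc_rat s.2)).+1).+1 by [].
by lia.
Qed.

End SizeBounds.

(** The promises behind the size bounds; quasi thick forests enter only later, through [leafy]. *)
Record instance := Instance {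
  inst_vertex : finType;
  inst_edge : rel inst_vertex;
  inst_weight : inst_vertex -> rat;
  inst_sym : symmetric inst_edge;
  inst_irr : irreflexive inst_edge;
  inst_ge0 : forall v, 0 <= inst_weight v }.

Definition enc_instance (i : instance) : tree :=
  enc_weighted_graph (@inst_edge i) (@inst_weight i).

Lemma ptime_elim_all :
  ptime enc_instance (fun i => enc_state (elim_all (@inst_edge i) (@inst_weight i))).
Proof.
have hX := ptime_id enc_instance.
have he : ptime enc_instance (fun i => enc_rel (@inst_edge i)) := ptime_fst hX.
have hw : ptime enc_instance (fun i => enc_weights (@inst_weight i)) := ptime_snd hX.
pose Inv i s := elim_inv (@inst_edge i) (@inst_weight i) s.
pose b i := ((#|inst_vertex i| * 4).+1 +
  (#|inst_vertex i| * (32 * (tree_size (enc_instance i)).+1 + 43).+1).+1 +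
  (32 * (tree_size (enc_instance i)).+1 + 43) + 2)%N.
have bb : pbound enc_instance b.
  by have := pbound_card he => bc; rewrite /b; pbound_tac.
have sb i s : Inv i s -> (tree_size (enc_state s) <= b i)%N.
  exact: enc_state_size_le (@inst_sym i) (@inst_irr i) (@inst_ge0 i) s.
(* Inner loops run on larger trees; a bound in the instance is also one in any tree from which the
   instance can be computed in polynomial time. *)
have lift J (C : J -> tree) (h : J -> instance) :
    ptime C (fun j => enc_instance (h j)) -> pbound C (b \o h).
  by move=> /ptime_size /pbound_comp; apply; apply: pbound_reindex bb.
apply: (ptime_foldl_inv (S := fun i => state (inst_vertex i)) (eS := fun i =>
  @enc_state (inst_vertex i))
  (eT := fun i => @enc_vertex (inst_vertex i)) (L := fun i => enum (inst_vertex i))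
  (step := fun i s _ => elim_round (@inst_edge i) s) (Inv := Inv) (b := b) _ _ bb).
- exact: ptime_vertices he.
- apply: ptime_node; last by apply: ptime_node hw (ptime_const _ (enc_rat 1)).
  apply: (eq_ptime (ptime_set (ptime_vertices he) (P := fun _ _ => true) _)).
    exact: (ptime_const _ (enc_bool true)).
  by move=> i; congr enc_set; apply/setP => v; rewrite !inE.
- by move=> i; apply: elim_inv_init; apply: inst_ge0.
- by move=> i s _; apply: elim_round_inv; [apply: inst_sym|apply: inst_irr].
- exact: sb.
set C := fun j => Node (Node _ _) _; have idC := ptime_id C.
have hXC := ptime_fst (ptime_fst idC); have hsC := ptime_snd (ptime_fst idC).
pose h1 (j : {j : {i & {s | Inv i s}} & inst_vertex (tag j)}) := tag (tag j).
have he1 : ptime C (fun j => enc_rel (@inst_edge (h1 j))) := ptime_trans hXC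
  (ptime_reindex h1 he).
apply: (ptime_foldl_inv (S := fun j => state (inst_vertex (h1 j)))
  (eS := fun j => @enc_state (inst_vertex (h1 j)))
  (eT := fun j => @enc_vertex (inst_vertex (h1 j))) (L := fun j => enum
    (inst_vertex (h1 j)))
  (step := fun j s x => foldl (fun s y => elim_step (@inst_edge (h1 j)) s x y) s
    (enum (inst_vertex (h1 j))))
  (Inv := fun j => @Inv (h1 j)) (b := b \o h1) _ hsC (lift _ _ _ hXC)).
- exact: ptime_vertices he1.
(* The inner loop starts from the state of the outer one, whose invariant is stored in the index
   [j]. *)
- by move=> j; apply: (svalP (tagged (tag j))).
- move=> j s x Is; apply: foldl_inv => // {Is}s y; apply: elim_step_inv.
    exact: inst_sym.
  exact: inst_irr.
- by move=> j s; apply: sb.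
set D := fun j => Node (Node _ _) _; have idD := ptime_id D.
have hXD := ptime_fst (ptime_fst idD); have hsD := ptime_snd (ptime_fst idD).
have hxD := ptime_snd idD.
pose h2 (j : {j : {j & {s | @Inv (h1 j) s}} & inst_vertex (h1 (tag j))}) := tag
  (tag j).
have he2 : ptime D (fun j => enc_rel (@inst_edge (h1 (h2 j)))) := ptime_trans hXD
  (ptime_reindex h2 he1).
have hXD' : ptime D (fun j => enc_instance (h1 (h2 j))) := ptime_trans hXD
  (ptime_reindex h2 hXC).
apply: (ptime_foldl_inv (S := fun j => state (inst_vertex (h1 (h2 j))))
  (eS := fun j => @enc_state (inst_vertex (h1 (h2 j))))
  (eT := fun j => @enc_vertex (inst_vertex (h1 (h2 j)))) (L := fun j => enum
    (inst_vertex (h1 (h2 j))))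
  (step := fun j s y => elim_step (@inst_edge (h1 (h2 j))) s (tagged j) y)
  (Inv := fun j => @Inv (h1 (h2 j))) (b := b \o (h1 \o h2)) _ hsD (lift _ _ _ hXD')).
- exact: ptime_vertices he2.
- by move=> j; apply: (svalP (tagged (tag j))).
- by move=> j s y; apply: elim_step_inv; [apply: inst_sym|apply: inst_irr].
- by move=> j s; apply: sb.
set E := fun j => Node (Node _ _) _; have idE := ptime_id E.
have hXE := ptime_fst (ptime_fst idE); have hsE := ptime_snd (ptime_fst idE).
have hyE := ptime_snd idE.
pose h3 (j : {j : {j & {s | @Inv (h1 (h2 j)) s}} & inst_vertex (h1 (h2 (tag j)))})
  := tag (tag j).
have he3 : ptime E (fun j => enc_rel (@inst_edge (h1 (h2 (h3 j))))) := ptime_trans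
  hXE (ptime_reindex h3 he2).
have hxE := ptime_trans hXE (ptime_reindex h3 hxD).
apply: (ptime_elim_step he3 hsE hxE hyE) => j.
  by case: (svalP (tagged (tag j))).
by case: (svalP (tagged (tag j))) => _ _ /ltW.
Qed.

Local Close Scope ring_scope.

Theorem mainTheorem8 :
  exists (p : cmd) (c k : nat),
  forall (V : finType) (e : rel V) (w : V -> rat),
    simple_graph e ->
    quasi_thick_forest e ->
    (forall v : V, (0 <= w v)%R) ->
    exists t : nat,
      runs p (enc_weighted_graph e w) t (enc_rat (indep_weight e w)) /\
      t <= c * tree_size (enc_weighted_graph e w) ^ k.
Proof.
(* The answer is the collected factor, the last component of the final state. *)
have [p [m [b [[c [k bb]] _ H]]]] := ptime_snd (ptime_snd ptime_elim_all).
exists p, c, k => V e w [e_sym e_irr] [atoms dec small_atoms] w_ge0.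
pose i := Instance e_sym e_irr w_ge0.
have lV : leafy e setT.
  apply: (leafy_decomposition e_sym dec) => A /small_atoms /orP[|/andP[+ _]].
    exact: clique_small.
  exact: cobipartite_small.
have [t [s [ex s0 _ tb]]] := H i [eta (fun=> Leaf) with 0%N |-> enc_instance i] erefl.
exists t; split; last exact: leq_trans tb (bb i).
by exists s => //; rewrite s0 elim_all_correct.
Qed.
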